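(* Let $\sigma>0$, let $W=(W_t)_{t\ge 0}$ be a one-dimensional standard Wiener process (with $W_0=0$), and let $X_t=\sigma W_t$. For $\eta>0$ define $t^{\eta}_0=0$ and, recursively for $i\ge 0$, $$t^{\eta}_{i+1}=\inf\{t>t^{\eta}_i : |X_t-X_{t^{\eta}_i}|=\eta\}.$$ For $t\geq 0$ let $N^{\eta}_t=\sup\{i\ge 0 : t^{\eta}_i\le t\}$ and $\varphi^{\eta}_t=\sum_{i=1}^{N^{\eta}_t}(t^{\eta}_i-t^{\eta}_{i-1})$. Fix $t>0$. Then $$\frac{1}{\eta}\left(X_t-X_{\varphi^{\eta}_t}\right)\ \longrightarrow\ \Lambda\quad\text{in distribution as }\eta\to 0,$$ where $\Lambda$ is a random variable with density function $f_{\Lambda}(z)=(1-|z|)^+$, $z\in\mathbb{R}$.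
   Context: Here $y^+=\max(y,0)$. The time $\varphi^{\eta}_t$ equals $t^{\eta}_{N^{\eta}_t}$, the last discretization time not exceeding $t$ (with an empty sum equal to $0$). The limit $\eta\to 0$ is taken through positive values of $\eta$. *)

(* Defs.v *)
From mathcomp Require Import all_boot all_order all_algebra.
From mathcomp Require Import all_classical all_reals all_analysis.

Set Implicit Arguments.
Unset Strict Implicit.
Unset Printing Implicit Defensive.

Import Order.TTheory GRing.Theory Num.Theory.
Import numFieldNormedType.Exports.

Local Open Scope classical_set_scope.
Local Open Scope ring_scope.

Definition mutually_independent d (T : measurableType d) (R : realType)
    (P : probability T R) (I : finType) (X : I -> T -> R) : Prop :=
  forall (J : {set I}) (B : I -> set R), (forall i, measurable (B i)) ->
    P (\bigcap_(i in [set` J]) (X i @^-1` B i)) =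
    (\prod_(i in J) P (X i @^-1` B i))%E.

(* The time set is [0, +oo[: the values of [W] at negative times are
   unconstrained and never used.  The second parameter of [normal_prob] is the
   standard deviation. *)
Record wiener_process d (T : measurableType d) (R : realType)
    (P : probability T R) (W : R -> T -> R) : Prop := WienerProcess {
  wiener_measurable : forall s : R, 0 <= s -> measurable_fun setT (W s) ;
  wiener_start : forall w : T, W 0 w = 0 ;
  wiener_independent_increments : forall (n : nat) (s : nat -> R),
    0 <= s 0%N -> nondecreasing_seq s ->
    mutually_independent P (fun (i : 'I_n) w => W (s i.+1) w - W (s i) w) ;
  wiener_normal_increments : forall (s u : R), 0 <= s -> s < u ->
    forall A : set R, measurable A ->
    P ((fun w => W u w - W s w) @^-1` A) = normal_prob 0 (Num.sqrt (u - s)) A ;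
  wiener_continuous : forall w : T,
    {within `[0, +oo[, continuous (fun s : R => W s w)} }.

Section discretization.
Context {R : realType}.
Variables (x : R -> R) (eta : R).

(* The infimum of the empty set is [+oo]; after an infinite time all the
   following ones are infinite, so that [fine] is only relevant on finite
   times. *)
Fixpoint discr_time (i : nat) : \bar R :=
  if i is j.+1 then
    ereal_inf [set s%:E | s in [set s : R |
      (discr_time j < s%:E)%E /\ `|x s - x (fine (discr_time j))| = eta]]
  else 0%E.

Definition discr_count (t : R) : \bar R :=
  ereal_sup [set (i%:R : R)%:E | i in [set i : nat | (discr_time i <= t%:E)%E]].

(* Only finite times occur in this sum, and its value lies in [0, t]. *)
Definition last_discr_time (t : R) : R :=
  fine (\sum_(1 <= i <oo | ((i%:R : R)%:E <= discr_count t)%E)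
          (discr_time i - discr_time i.-1))%E.

End discretization.

Definition has_density d (T : measurableType d) (R : realType)
    (P : probability T R) (X : {RV P >-> R}) (f : R -> R) : Prop :=
  [/\ measurable_fun setT f, forall z, 0 <= f z &
      forall A : set R, measurable A ->
        distribution P X A = (\int[lebesgue_measure]_(z in A) (f z)%:E)%E].

(* The measurability requirement says that [Y eta] is a random variable for
   every [eta > 0]. *)
Definition cvg_in_distribution_at0 d (T : measurableType d) (R : realType)
    (P : probability T R) (Y : R -> T -> R)
    d' (T' : measurableType d') (P' : probability T' R) (L : {RV P' >-> R}) :
    Prop :=
  (forall eta : R, 0 < eta -> measurable_fun setT (Y eta)) /\
  forall f : R -> R, continuous f -> bounded_fun f ->
    ('E_P[f \o Y eta])%E @[eta --> 0^'+] --> ('E_P'[f \o L])%E.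

(* Main.v *)
Require Import Defs.
From HB Require Import structures.
From mathcomp Require Import all_boot all_order all_algebra.
From mathcomp Require Import all_classical all_reals all_analysis.
From mathcomp Require Import measurable_realfun.
From mathcomp Require Import lra ring zify.

Set Implicit Arguments.
Unset Strict Implicit.
Unset Printing Implicit Defensive.

Import Order.TTheory GRing.Theory Num.Theory.
Import numFieldNormedType.Exports.

Local Open Scope classical_set_scope.
Local Open Scope ring_scope.

(** Write [Y] for the remainder [(X t - X phi) / eta].  The times at which the
    discretization stops are those at which the path reaches a point of the
    lattice [eta Z] other than the last one it met, so [X phi] is the last
    lattice point met before time [t]: it is the only multiple [k eta] such that
    the path passes through it and then stays at distance less than [eta] from
    it until [t] ([last_discr_time_spec], [last_discr_time_unique]).

    Read the path backwards from [t], and let [u] be the fractional part of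
    [X t / eta].  In units of [eta], the backward path starts at [u] in a cell
    [0, 1) of the lattice, and [X phi] is the end of that cell by which it
    leaves.  Hence [Y = u] if it leaves through [0] and [Y = u - 1] if it leaves
    through [1].  Two facts then give the limit law:
    - [u] is asymptotically uniform and independent of the backward increments
      on [t / 2, t], because [X t] is the sum of these increments and of the
      independent normal variable [X (t / 2)], whose density varies little at
      scale [eta] ([equidistribution]);
    - started at a fixed [v], the backward path leaves [0, 1) through [0] with
      probability close to [1 - v], by optional stopping of a martingale
      ([walk_lo_probability], [walk_hi_probability]).
    So [E f(Y)] is close to the integral over [0, 1) of
    [f v * (1 - v) + f (v - 1) * v], which is the expectation of [f] under the
    triangular density ([triangular_expectation]).

    Both facts are proved on a grid of [n] steps of [t / 2, t], where the
    backward path is a walk with independent increments.  To use them together,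
    one needs the outcome of the walk for all starting points at once.  It is
    encoded by two numbers [lo <= hi], functions of the increments only: the
    starting points below [lo] leave through [0], those above [hi] leave through
    [1], and those in between are undecided.  As [n] tends to infinity with
    [eta] fixed, the decisions of the walk become correct along every path
    ([last_discr_time_grid]), up to a margin that is then sent to [0].

    All the estimates are lower bounds for nonnegative [f]
    ([remainder_lower_bound]): applied to [C + f] and to [C - f] they bound
    [E f(Y)] from both sides ([remainder_expectation_gap]). *)

(** * The last lattice point visited by a continuous path *)

Lemma path_unif_continuous (R : realType) (x : R -> R) (t e : R) :
  {within `[0, +oo[, continuous x} -> 0 < e ->
  exists2 d : R, 0 < d & forall r s, 0 <= r <= t -> 0 <= s <= t ->
    `|r - s| < d -> `|x r - x s| < e.
Proof.
move=> cx e0.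
have cA s : 0 <= s -> forall e, 0 < e -> exists2 d : R, 0 < d &
    forall r, 0 <= r -> `|s - r| < d -> `|x s - x r| < e.
  move=> s0 e' e'0; have /subspace_continuousP/(_ s) := cx.
  rewrite /= in_itv/= andbT => /(_ s0)/cvgrPdist_lt/(_ _ e'0).
  case=> d /= d0 H; exists d => // r r0 sr; apply: H => //=.
  by rewrite in_itv/= andbT.
(* Compactness is applied with the modulus of continuity as the filter variable. *)
have /compact_near_coveringP/(_ _ (0^'+ : set_system R)
  (fun d s => 0 <= s -> forall r, 0 <= r -> `|s - r| < d -> `|x s - x r| < e)) :=
  @segment_compact R 0 t.
case=> [s|d /= d0 H].
  rewrite /= in_itv/= => /andP[s0 st].
  have [d d0 xd] := cA s s0 _ (divr_gt0 e0 (ltr0Sn R 1)).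
  exists (ball s (d / 2), [set a : R | 0 < a < d / 2]) => /=.
    split; first by apply: nbhsx_ballx; rewrite divr_gt0.
    near=> a => /=; apply/andP; split; first by near: a; exact: nbhs_right_gt.
    by near: a; apply: nbhs_right_lt; rewrite divr_gt0.
  move=> [u a] /= [su /andP[a0 ad]] u0 r r0 ur.
  rewrite -(subrKA (x s)) (le_lt_trans (ler_normD _ _))// [e]splitr ltrD//.
    by rewrite distrC xd// (lt_trans su)//; lra.
  by rewrite xd// -(subrKA u) (le_lt_trans (ler_normD _ _))//; move: su; rewrite /ball/=; lra.
have d20 : 0 < d / 2 by rewrite divr_gt0.
exists (d / 2) => // r s /andP[r0 rt] /andP[s0 _] rs.
apply: (H (d / 2) _ _ r) => //=; last by rewrite in_itv/= r0.
by rewrite sub0r normrN gtr0_norm//; lra.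
Unshelve. all: end_near. Qed.

Lemma path_ivt (R : realType) (x : R -> R) (a b v : R) :
  {within `[0, +oo[, continuous x} -> 0 <= a -> a <= b ->
  Num.min (x a) (x b) <= v <= Num.max (x a) (x b) ->
  exists2 c, a <= c <= b & x c = v.
Proof.
move=> cx a0 ab vab; have cab : {within `[a, b], continuous x}.
  apply: continuous_subspaceW cx => c /=; rewrite !in_itv/= => /andP[ac _].
  by rewrite (le_trans a0).
by have [c] := IVT ab cab vab; rewrite in_itv/= => ? <-; exists c.
Qed.

Section discretization_times.
Variables (R : realType) (x : R -> R) (eta : R).
Hypotheses (cx : {within `[0, +oo[, continuous x}) (x0 : x 0 = 0)
  (eta_gt0 : 0 < eta).

Local Notation tau := (discr_time x eta).

Lemma discr_time_le j : (tau j <= tau j.+1)%E.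
Proof. by apply: le_ereal_inf_tmp => _ [s [ts _] <-]; exact: ltW. Qed.

Lemma discr_time_nondecreasing i j : (i <= j)%N -> (tau i <= tau j)%E.
Proof.
move=> ij; rewrite -(subnKC ij); elim: (j - i)%N => [|k]; first by rewrite addn0.
by rewrite addnS => /le_trans; apply; exact: discr_time_le.
Qed.

Lemma discr_time_ge0 i : (0 <= tau i)%E.
Proof. exact: (@discr_time_nondecreasing 0). Qed.

Lemma discr_time_lb j r : (tau j < r%:E)%E ->
  `|x r - x (fine (tau j))| = eta -> (tau j.+1 <= r%:E)%E.
Proof. by move=> jr xr; apply: ereal_inf_lbound; exists r. Qed.

(** The infimum is attained since the path is continuous: the set of times at
    distance [eta] from the last point is closed, and it does not accumulate at
    the last time, where that distance is [0]. *)
Lemma discr_time_attained j s : tau j.+1 = s%:E ->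
  (tau j < s%:E)%E /\ `|x s - x (fine (tau j))| = eta.
Proof.
move=> js; have := discr_time_le j; rewrite js.
case E : (tau j) (discr_time_ge0 j) => [a| |]//=; rewrite lee_fin => a0.
rewrite lee_fin => als.
suff xsa : `|x s - x a| = eta.
  split=> //; rewrite lte_fin lt_neqAle als andbT; apply/eqP => as_.
  by move: xsa eta_gt0; rewrite as_ subrr normr0 => ->; rewrite ltxx.
apply/eqP; rewrite -subr_eq0; apply/negPn/negP => ne.
have e0 : 0 < `| `|x s - x a| - eta| by rewrite normr_gt0.
have s0 : 0 <= s by rewrite (le_trans a0).
have [d d0 xd] := path_unif_continuous (s + 1) cx e0.
pose d' := Num.min d 1.
have d'0 : 0 < d' by rewrite lt_min d0 ltr01.
have : (tau j.+1 < (s + d')%:E)%E by rewrite js lte_fin; lra.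
rewrite /= => /ereal_inf_lt [_ [r [/= jr xra] <-]]; rewrite lte_fin => rs.
have sr : s <= r.
  by rewrite -lee_fin -js; apply: discr_time_lb.
have d'd : d' <= d by rewrite ge_min lexx.
have d'1 : d' <= 1 by rewrite ge_min lexx orbT.
have : `|x s - x r| < `| `|x s - x a| - eta|.
  apply: xd; [apply/andP; split; lra..|].
  by rewrite distrC ger0_norm; lra.
move: xra; rewrite E /= => <-; apply/negP; rewrite -leNgt.
by rewrite (le_trans (ler_dist_dist _ _))// opprB addrA subrK.
Qed.

Lemma discr_time_lattice i s : tau i = s%:E -> exists k : int, x s = k%:~R * eta.
Proof.
elim: i s => [s [<-]|i IH s /discr_time_attained[]].
  by exists 0; rewrite x0 mul0r.
case E : (tau i) (discr_time_ge0 i) => [a| |]//= _ _.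
have [k xa] := IH _ E.
have [sa|sa] := lerP (x a) (x s).
  move=> sae; exists (k + 1).
  by rewrite rmorphD/= mulrDl mul1r -xa; lra.
move=> sae; exists (k - 1).
by rewrite rmorphB/= mulrBl mul1r -xa; lra.
Qed.

(** Otherwise the path would take a value at distance exactly [eta] before [t],
    by the intermediate value theorem. *)
Lemma discr_time_near t i a : tau i = a%:E -> (t%:E < tau i.+1)%E ->
  forall r, a <= r <= t -> `|x r - x a| < eta.
Proof.
move=> ia ti r /andP[ar rt]; rewrite ltNge; apply/negP => xra.
have a0 : 0 <= a by rewrite -lee_fin -ia discr_time_ge0.
have [c /andP[ac cr] xc] : exists2 c, a <= c <= r & `|x c - x a| = eta.
  have [ge0|lt0] := lerP 0 (x r - x a).
    have [|c acr xc] := @path_ivt R x a r (x a + eta) cx a0 ar.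
      move: xra; rewrite ger0_norm// => xra.
      rewrite ge_min le_max lerDl (ltW eta_gt0)/= orbC.
      have -> : x a + eta <= x r by lra.
      by [].
    by exists c => //; rewrite xc [X in `|X|]addrC addKr gtr0_norm.
  have [|c acr xc] := @path_ivt R x a r (x a - eta) cx a0 ar.
    move: xra; rewrite ltr0_norm// => xra.
    rewrite ge_min le_max gerBl (ltW eta_gt0)/= andbT orbC.
    have -> : x r <= x a - eta by lra.
    by [].
  by exists c => //; rewrite xc [X in `|X|]addrC addKr normrN gtr0_norm.
have ac' : (tau i < c%:E)%E.
  rewrite ia lte_fin lt_neqAle ac andbT; apply/eqP => E.
  by move: xc eta_gt0; rewrite E subrr normr0 => ->; rewrite ltxx.
have /(lt_le_trans ti) : (tau i.+1 <= c%:E)%E by apply: discr_time_lb => //; rewrite ia.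
by rewrite lte_fin; lra.
Qed.

(** By uniform continuity on [0, t], the times below [t] are separated by a
    positive constant, so that only finitely many of them occur. *)
Lemma discr_time_last t : 0 <= t ->
  exists N, (tau N <= t%:E)%E /\ (t%:E < tau N.+1)%E.
Proof.
move=> t0; apply: contrapT => H.
(* If there is no last time, then all of them are at most [t]. *)
have {}H i : (tau i <= t%:E)%E.
  elim: i => [|i IH]; first by rewrite /= lee_fin.
  by rewrite leNgt; apply/negP => ti; apply: H; exists i.
have [d d0 xd] := path_unif_continuous t cx eta_gt0.
have tauE i : exists2 a, tau i = a%:E & 0 <= a <= t.
  case E : (tau i) (discr_time_ge0 i) (H i) => [a| |]//.
  by rewrite !lee_fin => a0 at_; exists a => //; rewrite a0.
have taud i : ((i%:R * d)%:E <= tau i)%E.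
  elim: i => [|i IH]; first by rewrite mul0r.
  have [a ia /andP[a0 at_]] := tauE i; have [b ib /andP[b0 bt]] := tauE i.+1.
  rewrite ib lee_fin; have [] := discr_time_attained ib; rewrite ia lte_fin [fine _]/= => ab xba.
  move: IH; rewrite ia lee_fin => IH.
  have : d <= b - a.
    rewrite leNgt; apply/negP => bad.
    have := xd b a; rewrite xba ltxx b0 a0 at_ bt.
    by rewrite ger0_norm; [move=> /(_ isT isT bad)|lra].
  by rewrite -natr1 mulrDl mul1r; lra.
have := le_trans (taud (Num.truncn (t / d)).+1) (H _).
rewrite lee_fin leNgt -ltr_pdivrMr//.
by rewrite truncnS_gt.
Qed.

(** The sum defining the last time telescopes to the [N]-th time. *)
Lemma last_discr_timeE t N : 0 <= t ->
  (tau N <= t%:E)%E -> (t%:E < tau N.+1)%E -> last_discr_time x eta t = fine (tau N).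
Proof.
move=> t0 Nt tN.
have cE : discr_count x eta t = N%:R%:E.
  apply/eqP; rewrite eq_le; apply/andP; split.
    apply: ge_ereal_sup => _ [i /= it <-]; rewrite lee_fin ler_nat leqNgt.
    apply/negP => /discr_time_nondecreasing Ni.
    by have := lt_le_trans tN (le_trans Ni it); rewrite ltxx.
  by apply: ereal_sup_ubound; exists N.
rewrite /last_discr_time cE; congr fine.
have fin i : (i <= N)%N -> tau i \is a fin_num.
  move=> /discr_time_nondecreasing /le_trans/(_ Nt).
  by case: (tau i) (discr_time_ge0 i).
rewrite (_ : tau N = \sum_(1 <= i < N.+1) (tau i - tau i.-1))%E.
  apply: (@lim_near_cst _ _ _) => //=; exists N.+1 => // n /= Nn.
  rewrite (@big_cat_nat _ _ _ N.+1)//=.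
  rewrite [X in (_ + X)%E]big_nat_cond [X in (_ + X)%E]big1 ?adde0.
    by rewrite [LHS]big_nat_cond [RHS]big_nat_cond; apply: eq_bigl => i;
       rewrite lee_fin ler_nat andbT; case: (ltnP i N.+1) => iN;
       rewrite ?ltnS in iN *; rewrite ?iN ?andbT ?andbF.
  move=> i /andP[/andP[Ni _]]; rewrite lee_fin ler_nat => iN.
  by move: Ni; rewrite ltnNge iN.
rewrite big_add1/= telescope_sume//=.
  by rewrite oppr0 adde0.
Qed.

End discretization_times.

(** The witness is the last time at which the path is at most [l]. *)
Lemma path_last_passage (R : realType) (y : R -> R) (q t l : R) :
  {within `[0, +oo[, continuous y} -> 0 <= q -> q <= t -> y q <= l -> l <= y t ->
  exists s, [/\ q <= s <= t, y s = l & forall r, s <= r <= t -> l <= y r].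
Proof.
move=> cy q0 qt yq yt.
pose A := [set r | q <= r <= t /\ y r <= l].
have Aq : A q by split; rewrite ?lexx.
have hsA : has_sup A by split; [exists q|exists t => r [/andP[]]].
pose s := sup A.
have qs : q <= s by exact: sup_upper_bound.
have st : s <= t by apply: sup_le_ub; [exists q|move=> r [/andP[]]].
have s0 : 0 <= s by exact: le_trans qs.
have above r : s < r -> r <= t -> l < y r.
  move=> sr rt; rewrite ltNge; apply/negP => yrl.
  suff : r <= s by rewrite leNgt sr.
  by apply: sup_upper_bound => //; split; rewrite // rt andbT (le_trans qs)// ltW.
have ysl : y s <= l.
  rewrite leNgt; apply/negP => lys.
  have [d d0 yd] := path_unif_continuous t cy (e := y s - l) ltac:(by rewrite subr_gt0).
  have [r [/andP[qr rt] yr]] := sup_adherent d0 hsA; rewrite -/s => sr.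
  have rs : r <= s by apply: sup_upper_bound => //; split; rewrite ?qr.
  have := yd s r; rewrite s0 st rt (le_trans q0 qr).
  rewrite ger0_norm ?subr_ge0//; have -> : s - r < d by lra.
  move=> /(_ isT isT isT); apply/negP; rewrite -leNgt.
  by rewrite (le_trans _ (ler_norm _))//; lra.
have yse : y s = l.
  apply/eqP; rewrite eq_le ysl/= leNgt; apply/negP => ysl'.
  have st' : s < t.
    by rewrite lt_neqAle st andbT; apply/eqP => E; move: ysl' yt; rewrite E; lra.
  have [d d0 yd] := path_unif_continuous t cy (e := l - y s) ltac:(by rewrite subr_gt0).
  pose r := Num.min t (s + d / 2).
  have rt : r <= t by rewrite ge_min lexx.
  have sr : s < r by rewrite lt_min st'/=; lra.
  have rd : r <= s + d / 2 by rewrite ge_min lexx orbT.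
  have := yd r s; rewrite s0 st rt (le_trans s0 (ltW sr)).
  rewrite ger0_norm ?subr_ge0 ?ltW//; have -> : r - s < d by lra.
  move=> /(_ isT isT isT); apply/negP; rewrite -leNgt.
  have lyr := above _ sr rt.
  by rewrite (le_trans _ (ler_norm _))//; lra.
exists s; split => //; first by rewrite qs.
move=> r /andP[]; rewrite le_eqVlt => /predU1P[<- _|sr rt]; first by rewrite yse.
by rewrite ltW// above.
Qed.

Section last_lattice_point.
Variables (R : realType) (x : R -> R) (eta t : R).
Hypotheses (cx : {within `[0, +oo[, continuous x}) (x0 : x 0 = 0)
  (eta_gt0 : 0 < eta) (t_ge0 : 0 <= t).

Let phi := last_discr_time x eta t.

Lemma last_discr_time_spec : [/\ 0 <= phi <= t, exists k : int, x phi = k%:~R * eta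
  & forall r, phi <= r <= t -> `|x r - x phi| < eta].
Proof.
have [N [Nt tN]] := discr_time_last cx eta_gt0 t_ge0.
have phiE := last_discr_timeE t_ge0 Nt tN.
case E : (discr_time x eta N) (discr_time_ge0 x eta N) Nt => [a| |]//.
rewrite !lee_fin => a0 at_.
rewrite /phi phiE E/=; split; first by rewrite a0.
  exact: discr_time_lattice E.
exact: discr_time_near tN.
Qed.

Lemma lattice_dist_lt (j k : int) :
  `|j%:~R * eta - k%:~R * eta| < eta -> j = k.
Proof.
rewrite -mulrBl normrM (gtr0_norm eta_gt0) gtr_pMl// -rmorphB/= -intr_norm.
by rewrite (ltr_int _ _ 1) => H; apply/eqP; rewrite -subr_eq0 -normr_eq0; lia.
Qed.

(** Of two times with this property, the earlier one sees the lattice point of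
    the later one at distance less than [eta]; the two points then coincide. *)
Lemma last_discr_time_unique s (k : int) : 0 <= s <= t -> x s = k%:~R * eta ->
  (forall r, s <= r <= t -> `|x r - k%:~R * eta| < eta) -> x phi = k%:~R * eta.
Proof.
move=> /andP[s0 st] xs near_s.
have [/andP[phi0 phit] [j xphi] near_phi] := last_discr_time_spec.
rewrite xphi; congr (_%:~R * _); have [sphi|phis] := leP s phi.
  by apply: lattice_dist_lt; rewrite -xphi near_s// sphi.
apply/esym/lattice_dist_lt.
by rewrite -xs -xphi near_phi// st ltW.
Qed.

(** Backwards from [t], the path leaves the cell between [k] and [k + 1] through
    [k]; the last passage at [k] is then the last visit of the lattice. *)
Lemma last_discr_time_bottom q (k : int) : 0 <= q <= t ->
  x q <= k%:~R * eta <= x t ->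
  (forall r, q <= r <= t -> x r < (k + 1)%:~R * eta) -> x phi = k%:~R * eta.
Proof.
move=> /andP[q0 qt] /andP[xq xt] H.
have [s [/andP[qs st] xs xr]] := path_last_passage cx q0 qt xq xt.
apply: (last_discr_time_unique _ xs); first by rewrite st (le_trans q0).
move=> r /andP[sr rt]; rewrite ger0_norm ?subr_ge0 ?xr ?sr//.
by have := H r; rewrite (le_trans qs sr) rt intrD mulrDl mul1r => /(_ isT); lra.
Qed.

(** The mirror image of [last_discr_time_bottom], obtained from the last passage
    of the opposite path. *)
Lemma last_discr_time_top q (k : int) : 0 <= q <= t ->
  x t <= k%:~R * eta <= x q ->
  (forall r, q <= r <= t -> (k - 1)%:~R * eta < x r) -> x phi = k%:~R * eta.
Proof.
move=> /andP[q0 qt] /andP[xt xq] H.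
have cNx : {within `[0, +oo[, continuous (fun r => - x r)}.
  by move=> r; apply: continuousN; exact: cx.
have [||s [/andP[qs st] xs xr]] := path_last_passage cNx q0 qt (l := - (k%:~R * eta)).
- by rewrite lerN2.
- by rewrite lerN2.
have {}xs : x s = k%:~R * eta by apply: oppr_inj.
apply: (last_discr_time_unique _ xs); first by rewrite st (le_trans q0).
move=> r /andP[sr rt]; rewrite ler0_norm.
  by have := H r; rewrite (le_trans qs sr) rt intrB mulrBl mul1r => /(_ isT); lra.
by have := xr r; rewrite sr rt lerN2 subr_le0 => /(_ isT).
Qed.

End last_lattice_point.

(** * A discrete walk between two barriers, for all starting points at once *)

Section two_barriers.
Variable R : realType.
Implicit Types (z : nat -> R) (v e : R).

(** A state is [(s, (lo, hi))], where [s] is the displacement of the walk and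
    (lo, hi) is the set of the starting points [v] in the unit interval for
    which the walk [v + s] has not yet left it.  The step clamps [- s] and
    [1 - s] between [lo] and [hi]: the starting points below [- s] have just left
    through [0], those above [1 - s] have just left through [1], and the state no
    longer changes its [lo] and [hi] once they are equal. *)
Definition walk_step (q : R * (R * R)) (y : R) : R * (R * R) :=
  let s := q.1 + y in
  (s, (Num.max q.2.1 (Num.min (- s) q.2.2), Num.min q.2.2 (Num.max (1 - s) q.2.1))).

Fixpoint walk_state z n : R * (R * R) :=
  if n is m.+1 then walk_step (walk_state z m) (z m) else (0, (0, 1)).

Definition walk_pos z n := (walk_state z n).1.
Definition walk_lo z n := (walk_state z n).2.1.
Definition walk_hi z n := (walk_state z n).2.2.

Lemma walk_posS z n : walk_pos z n.+1 = walk_pos z n + z n.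
Proof. by []. Qed.

Lemma walk_loS z n : walk_lo z n.+1 =
  Num.max (walk_lo z n) (Num.min (- walk_pos z n.+1) (walk_hi z n)).
Proof. by []. Qed.

Lemma walk_hiS z n : walk_hi z n.+1 =
  Num.min (walk_hi z n) (Num.max (1 - walk_pos z n.+1) (walk_lo z n)).
Proof. by []. Qed.

Lemma walk_posE z n : walk_pos z n = \sum_(0 <= i < n) z i.
Proof.
elim: n => [|n IH]; first by rewrite big_geq.
by rewrite walk_posS IH big_nat_recr.
Qed.

Lemma walk_lo_hi z n : [/\ 0 <= walk_lo z n, walk_lo z n <= walk_hi z n & walk_hi z n <= 1].
Proof.
elim: n => [|n [lo0 lohi hi1]]; first by rewrite /walk_lo/walk_hi/= lexx ler01.
split.
- by rewrite walk_loS le_max lo0.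
- rewrite walk_loS walk_hiS le_min !ge_max lohi ge_min lexx orbT/= le_max lexx orbT/=.
  rewrite le_max ge_min; apply/orP; left; apply/orP; left; lra.
- by rewrite walk_hiS ge_min hi1.
Qed.

(** Reflecting the unit interval exchanges the two barriers.  This reduces every
    statement about [hi] to the same statement about [lo]. *)
Lemma walk_stateN z n : walk_state (fun i => - z i) n =
  (- walk_pos z n, (1 - walk_hi z n, 1 - walk_lo z n)).
Proof.
elim: n => [|n IH]; first by rewrite /walk_pos/walk_lo/walk_hi/= subr0 subrr oppr0.
rewrite [LHS]/= IH /walk_step/= -opprD -walk_posS; congr (_, (_, _)).
- rewrite walk_hiS opprK /Num.max /Num.min; do ! case: ifPn; rewrite -?leNgt; lra.
- rewrite walk_loS opprK /Num.max /Num.min; do ! case: ifPn; rewrite -?leNgt; lra.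
Qed.

(** Reaching [1 - v] while [lo] has not passed [v] would bring [hi] down to [v]. *)
Lemma walk_pos_lt z v n : 0 <= v < 1 -> walk_lo z n <= v -> v < walk_hi z n ->
  forall i, (i <= n)%N -> walk_pos z i < 1 - v.
Proof.
move=> v01; elim: n => [|n IH] lov vhi i.
  by rewrite leqn0 => /eqP ->; rewrite /walk_pos/=; lra.
have [_ lohi _] := walk_lo_hi z n.
move: lov vhi; rewrite walk_loS walk_hiS ge_max lt_min lt_max.
move=> /andP[lov _] /andP[vhi]; rewrite [X in _ || X]ltNge lov orbF => vS.
by rewrite leq_eqVlt => /predU1P[->|]; [lra|rewrite ltnS; exact: IH].
Qed.

(** The index [j] is the first one at which [lo] exceeds [v]. *)
Lemma walk_lo_exit z v n : 0 <= v < 1 -> v < walk_lo z n ->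
  exists2 j, (j <= n)%N & walk_pos z j < - v /\
    forall i, (i <= j)%N -> walk_pos z i < 1 - v.
Proof.
move=> v01; elim: n => [|n IH]; first by rewrite /walk_lo/=; lra.
have [vlo _|lov] := ltP v (walk_lo z n).
  by have [j jn H] := IH vlo; exists j => //; exact: leqW.
rewrite walk_loS lt_max ltNge lov/= lt_min => /andP[vS vhi].
exists n.+1 => //; split; first by lra.
move=> i; rewrite leq_eqVlt => /predU1P[->|]; first by lra.
by rewrite ltnS; exact: walk_pos_lt.
Qed.

Lemma walk_hi_exit z v n : 0 < v <= 1 -> walk_hi z n < v ->
  exists2 j, (j <= n)%N & 1 - v < walk_pos z j /\
    forall i, (i <= j)%N -> - v < walk_pos z i.
Proof.
move=> v01 hiv; have [||j jn []] := @walk_lo_exit (fun i => - z i) (1 - v) n.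
- lra.
- by rewrite /walk_lo walk_stateN/=; lra.
rewrite {1}/walk_pos walk_stateN/= => Sj Si; exists j => //; split; first by lra.
by move=> i /Si; rewrite {1}/walk_pos walk_stateN/=; lra.
Qed.

Definition walk_undecided z v n := walk_lo z n < v < walk_hi z n.

Lemma walk_undecided_range z v n : 0 < v < 1 -> walk_undecided z v n ->
  - v < walk_pos z n < 1 - v.
Proof.
move=> v01 /andP[lov vhi]; apply/andP; split; last first.
  by apply: (walk_pos_lt _ (ltW lov) vhi) => //; lra.
have := @walk_pos_lt (fun i => - z i) (1 - v) n _ _ _ n (leqnn n).
rewrite /walk_lo /walk_hi /walk_pos walk_stateN/= -/(walk_pos _ _).
by rewrite -/(walk_lo _ _) -/(walk_hi _ _) => H; rewrite ltrNl; move: H; rewrite subKr; apply; lra.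
Qed.

Lemma walk_undecidedS z v n : walk_undecided z v n.+1 -> walk_undecided z v n.
Proof.
rewrite /walk_undecided walk_loS walk_hiS gt_max lt_min.
by move=> /andP[/andP[-> _] /andP[-> _]].
Qed.

(** The walk started at [v], minus [v], stopped when it leaves the unit interval.
    It is a martingale transform of the walk. *)
Fixpoint walk_stopped z v n : R :=
  if n is m.+1 then walk_stopped z v m + (if walk_undecided z v m then z m else 0)
  else 0.

Lemma walk_stoppedE z v n : walk_undecided z v n -> walk_stopped z v n = walk_pos z n.
Proof.
elim: n => [|n IH] un; first by [].
have un' := walk_undecidedS un.
by rewrite /= un' IH// walk_posS.
Qed.

(** A bound on the overshoot over a barrier by a fourth moment, which is of order
    [n ^- 2] for each of the [n] steps and so vanishes after summation. *)
Lemma ler_pow4 e (y : R) : 0 < e -> `|y| <= e + y ^+ 4 / e ^+ 3.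
Proof.
move=> e0; have e3 : 0 < e ^+ 3 by rewrite exprn_gt0.
have y4 : 0 <= y ^+ 4 by rewrite exprn_even_ge0.
have [ye|ey] := leP `|y| e.
  by rewrite (le_trans ye)// lerDl divr_ge0// ltW.
have H : `|y| <= y ^+ 4 / e ^+ 3.
  rewrite ler_pdivlMr//.
  have -> : y ^+ 4 = `|y| * `|y| ^+ 3 by rewrite -exprS -normrX ger0_norm.
  by rewrite ler_wpM2l// lerXn2r ?nnegrE//; apply/ltW.
by rewrite (le_trans H)// lerDr ltW.
Qed.

(** A bound valid for all steps at once of the distance by which the walk jumps
    over a barrier. *)
Definition overshoot z e n := e + (\sum_(0 <= i < n) z i ^+ 4) / e ^+ 3.

Lemma overshoot_step z e n : 0 < e -> `|z n| <= overshoot z e n.+1.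
Proof.
move=> e0; rewrite (le_trans (ler_pow4 _ e0))// lerD2l ler_pM2r ?invr_gt0 ?exprn_gt0//.
by rewrite big_nat_recr//= lerDr sumr_ge0// => i _; rewrite exprn_even_ge0.
Qed.

Lemma overshoot_le z e n : 0 < e -> overshoot z e n <= overshoot z e n.+1.
Proof.
move=> e0; rewrite lerD2l ler_pM2r ?invr_gt0 ?exprn_gt0//.
by rewrite big_nat_recr//= lerDl exprn_even_ge0.
Qed.

Lemma overshoot_gt0 z e n : 0 < e -> 0 < overshoot z e n.
Proof.
move=> e0; rewrite ltr_pwDl// divr_ge0//.
  by apply: sumr_ge0 => i _; rewrite exprn_even_ge0.
by rewrite exprn_ge0// ltW.
Qed.

(** The stopped walk is never much below [- v], and it is above [1 - v] when [v]
    has been decided by the upper barrier, that is when [hi] has reached [v]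
    while [lo] has not. *)
Lemma walk_stopped_ge z v e n : 0 < e -> 0 < v < 1 ->
  - v - overshoot z e n <= walk_stopped z v n /\
  (walk_lo z n < v -> walk_hi z n <= v -> 1 - v <= walk_stopped z v n).
Proof.
move=> e0 v01; elim: n => [|n [IH1 IH2]].
  have := overshoot_gt0 z 0 e0; rewrite /walk_lo/walk_hi/=; split; lra.
have zn := overshoot_step z n e0; have le := overshoot_le z n e0.
have := walk_lo_hi z n => -[_ lohi _]; have := walk_lo_hi z n.+1 => -[_ lohi' _].
have zn' : - z n <= `|z n| by rewrite -normrN ler_norm.
rewrite /=; case: ifPn => [un|nun].
  rewrite (walk_stoppedE un); have un' := walk_undecided_range v01 un; split; first by lra.
  move: un => /andP[lov vhi].
  rewrite walk_loS walk_hiS gt_max ge_min leNgt vhi/= ge_max -walk_posS.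
  by move=> _ /andP[]; lra.
rewrite addr0; split; first by lra.
rewrite walk_loS gt_max => /andP[lov _] _; apply: IH2 => //.
by move: nun; rewrite /walk_undecided lov/= -leNgt.
Qed.

(** In expectation this bounds the probability of leaving through [1] by [v] plus
    the mean overshoot, since the stopped walk has mean [0]. *)
Lemma walk_top_le z v e n : 0 < e -> 0 < v < 1 ->
  (if (walk_lo z n < v) && (walk_hi z n <= v) then 1 else 0) <=
  walk_stopped z v n + v + overshoot z e n.
Proof.
move=> e0 v01; have := overshoot_gt0 z n e0.
have [] := walk_stopped_ge z n e0 v01; case: ifPn => [/andP[a b]|_] /=; last by lra.
by move=> _ /(_ a b); lra.
Qed.

End two_barriers.

(** * Processes driven by independent variables *)

Section independent_pair.
Context d (T : measurableType d) dE (E : measurableType dE) (R : realType).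
Variables (P : probability T R) (Q : T -> E) (Z : T -> R).
Hypotheses (mQ : measurable_fun setT Q) (mZ : measurable_fun setT Z).

Let Qm : {mfun T >-> E} := HB.pack Q (isMeasurableFun.Build _ _ _ _ _ mQ).
Let Zm : {mfun T >-> R} := HB.pack Z (isMeasurableFun.Build _ _ _ _ _ mZ).
Let mQZ : measurable_fun setT (fun w => (Q w, Z w)).
Proof. exact: measurable_fun_pair. Qed.
Let QZ : {mfun T >-> (E * R)%type} :=
  HB.pack (fun w => (Q w, Z w)) (isMeasurableFun.Build _ _ _ _ _ mQZ).

Let pair_law (F : set T) (nu : {finite_measure set R -> \bar R}) :
  measurable F ->
  (forall D B, measurable D -> measurable B ->
    P (Q @^-1` D `&` (Z @^-1` B `&` F)) = (P (Q @^-1` D) * nu B)%E) ->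
  forall A : set (E * R), measurable A ->
  P ((fun w => (Q w, Z w)) @^-1` A `&` F) = (distribution P Qm \x nu)%E A.
Proof.
move=> mF H A mA.
pose m := pushforward (mrestr P mF) QZ.
rewrite (@product_measure_unique _ _ _ _ _ (distribution P Qm) nu m)//.
by move=> D B mD mB; rewrite -H// /m /pushforward /mrestr setIA.
Qed.

(** If [Z] is independent of [Q] and of the future event [F], jointly on
    rectangles, then every event of the pair [(Q, Z)] is independent of [F]: both
    sides are measures on the product space that agree on rectangles. *)
Lemma independent_pair_event (F : set T) : measurable F ->
  (forall D B, measurable D -> measurable B ->
    P (Q @^-1` D `&` Z @^-1` B) = (P (Q @^-1` D) * P (Z @^-1` B))%E) ->
  (forall D B, measurable D -> measurable B ->
    P (Q @^-1` D `&` (Z @^-1` B `&` F)) =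
    (P (Q @^-1` D) * (P (Z @^-1` B) * P F))%E) ->
  forall A : set (E * R), measurable A ->
  P ((fun w => (Q w, Z w)) @^-1` A `&` F) =
  (P ((fun w => (Q w, Z w)) @^-1` A) * P F)%E.
Proof.
move=> mF QZind QZF A mA.
have pF0 : 0 <= fine (P F) by rewrite fine_ge0.
have pFE : (fine (P F))%:E = P F by rewrite fineK// fin_num_measure.
pose p : {nonneg R} := NngNum pF0.
rewrite (@pair_law _ (mscale p (distribution P Zm)))//; last first.
  move=> D B mD mB; rewrite QZF//; congr (_ * _)%E.
  by rewrite muleC -pFE.
rewrite muleC -pFE.
rewrite (@product_measure_unique _ _ _ _ _ _ _ (mscale p (distribution P QZ)))//.
move=> D B mD mB; transitivity ((fine (P F))%:E * (P (Q @^-1` D) * P (Z @^-1` B)))%E.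
  by rewrite -QZind.
by rewrite muleCA.
Qed.

(** The integral over the pair can be computed with an independent copy of [Z]. *)
Lemma independent_pair_integral (g : E * R -> \bar R) :
  (forall D B, measurable D -> measurable B ->
    P (Q @^-1` D `&` Z @^-1` B) = (P (Q @^-1` D) * P (Z @^-1` B))%E) ->
  measurable_fun [set: E * R] g -> (forall x, 0 <= g x)%E ->
  (\int[P]_w g (Q w, Z w) = \int[P]_w \int[P]_w' g (Q w, Z w'))%E.
Proof.
move=> QZind mg g0.
transitivity (\int[distribution P QZ]_x g x)%E.
  by rewrite ge0_integral_distribution.
transitivity (\int[distribution P Qm \x distribution P Zm]_x g x)%E.
  apply: eq_measure_integral => A mA _.
  transitivity (P ((fun w => (Q w, Z w)) @^-1` A `&` setT)); first by rewrite setIT.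
  by apply: pair_law => // D B mD mB; rewrite setIT QZind.
rewrite fubini_tonelli1// ge0_integral_distribution//.
- apply: eq_integral => w _; rewrite /= /fubini_F ge0_integral_distribution//.
  by apply: measurableT_comp => //; exact: measurable_pair1.
- exact: measurable_fun_fubini_tonelli_F.
- by move=> x; apply: integral_ge0.
Qed.

End independent_pair.

Fixpoint driven_process (T E R : Type) (Z : nat -> T -> R) (e0 : E) (g : E * R -> E)
    j (w : T) : E :=
  if j is i.+1 then g (driven_process Z e0 g i w, Z i w) else e0.

(** The product rule for the full family; the sub-families are recovered by taking
    some of the sets equal to [setT]. *)
Definition independent_sequence d (T : measurableType d) (R : realType)
    (P : probability T R) n (Z : nat -> T -> R) : Prop :=
  forall B : nat -> set R, (forall i, measurable (B i)) ->
  P (\bigcap_(i in `I_n) (Z i @^-1` B i)) =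
  (\prod_(0 <= i < n) P (Z i @^-1` B i))%E.

Section driven_process.
Context d (T : measurableType d) dE (E : measurableType dE) (R : realType).
Variables (P : probability T R) (n : nat) (Z : nat -> T -> R).
Variables (e0 : E) (g : E * R -> E).

Local Notation process := (driven_process Z e0 g).

Hypotheses (mZ : forall i, measurable_fun setT (Z i)) (mg : measurable_fun [set: E * R] g)
  (indZ : independent_sequence P n Z).

Lemma measurable_driven_process j : measurable_fun setT (process j).
Proof.
elim: j => [|j IH] /=; first exact: measurable_cst.
apply: (measurableT_comp mg); exact: measurable_fun_pair.
Qed.

Let future j (B : nat -> set R) := \bigcap_(i in [set i | (j <= i < n)%N]) (Z i @^-1` B i).

Let measurable_future j B : (forall i, measurable (B i)) -> measurable (future j B).
Proof.
move=> mB; apply: bigcap_measurableType => i _; rewrite -[X in measurable X]setTI; exact: mZ.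
Qed.

Let future_split j B : (j < n)%N -> future j B = Z j @^-1` B j `&` future j.+1 B.
Proof.
move=> jn; apply/seteqP; split => [w H|w [Hj H] i /= /andP[]].
  split; first by apply: H; rewrite /= leqnn.
  by move=> i /= /andP[ji ni]; apply: H; rewrite /= ltnW.
by rewrite leq_eqVlt => /predU1P[<- //|ji ni]; apply: H; rewrite /= ji.
Qed.

(** By induction on [j]: the state at time [j + 1] is a function of the pair made of
    the state at time [j] and of [Z j], so [independent_pair_event] applies.  This
    avoids the sigma-algebra generated by the first [j] variables. *)
Lemma driven_process_future j D B : (j <= n)%N -> measurable D ->
  (forall i, measurable (B i)) ->
  P (process j @^-1` D `&` future j B) =
  (P (process j @^-1` D) * \prod_(j <= i < n) P (Z i @^-1` B i))%E.
Proof.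
elim: j D B => [|j IH] D B jn mD mB.
  have -> : future 0 B = \bigcap_(i in `I_n) (Z i @^-1` B i) by [].
  have [De|De] := pselect (D e0).
    have -> : process 0 @^-1` D = setT by apply/seteqP; split.
    by rewrite setTI probability_setT mul1e indZ.
  have -> : process 0 @^-1` D = set0 by apply/seteqP; split.
  by rewrite set0I measure0 mul0e.
have mQ := measurable_driven_process j.
have PF : P (future j.+1 B) = (\prod_(j.+1 <= i < n) P (Z i @^-1` B i))%E.
  (* The case of the present set equal to [setT] isolates the future. *)
  pose B' i := if i == j then setT else B i.
  have mB' i : measurable (B' i) by rewrite /B'; case: ifP.
  have := IH setT B' (ltnW jn) measurableT mB'.
  rewrite preimage_setT setTI probability_setT mul1e future_split//.
  rewrite /B' eqxx preimage_setT setTI big_ltn// eqxx preimage_setT probability_setT mul1e.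
  have -> : future j.+1 (fun i => if i == j then setT else B i) = future j.+1 B.
    by apply: eq_bigcapr => i /= /andP[ji _]; rewrite gtn_eqF.
  by move=> ->; apply: eq_big_nat => i /andP[ji _]; rewrite gtn_eqF.
have QZF C A : measurable C -> measurable A ->
    P (process j @^-1` C `&` (Z j @^-1` A `&` future j.+1 B)) =
    (P (process j @^-1` C) * (P (Z j @^-1` A) * P (future j.+1 B)))%E.
  move=> mC mA; pose B' i := if i == j then A else B i.
  have mB' i : measurable (B' i) by rewrite /B'; case: ifP.
  have := IH C B' (ltnW jn) mC mB'.
  rewrite future_split// /B' eqxx big_ltn// eqxx PF.
  have -> : future j.+1 (fun i => if i == j then A else B i) = future j.+1 B.
    by apply: eq_bigcapr => i /= /andP[ji _]; rewrite gtn_eqF.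
  move=> ->; do 2 congr (_ * _)%E; apply: eq_big_nat => i /andP[ji _]; by rewrite gtn_eqF.
have QZ C A : measurable C -> measurable A ->
    P (process j @^-1` C `&` Z j @^-1` A) =
    (P (process j @^-1` C) * P (Z j @^-1` A))%E.
  move=> mC mA; pose B' i := if i == j then A else setT.
  have mB' i : measurable (B' i) by rewrite /B'; case: ifP.
  have := IH C B' (ltnW jn) mC mB'.
  rewrite future_split// /B' eqxx big_ltn// eqxx.
  have -> : future j.+1 (fun i => if i == j then A else setT) = setT.
    apply/seteqP; split => // w _ i /= /andP[ji _]; by rewrite gtn_eqF.
  rewrite setIT => ->; congr (_ * _)%E; rewrite [X in (_ * X)%E]big1_seq ?mule1//.
  move=> i /andP[_]; rewrite mem_index_iota => /andP[ji _].
  by rewrite gtn_eqF// preimage_setT probability_setT.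
rewrite -PF; have := independent_pair_event mQ (mZ j) (measurable_future j.+1 mB) QZ QZF.
by move=> /(_ (g @^-1` D)); apply; rewrite -[X in measurable X]setTI; exact: mg.
Qed.

Lemma driven_process_independent j D B : (j < n)%N -> measurable D -> measurable B ->
  P (process j @^-1` D `&` Z j @^-1` B) =
  (P (process j @^-1` D) * P (Z j @^-1` B))%E.
Proof.
move=> jn mD mB; pose B' i := if i == j then B else setT.
have mB' i : measurable (B' i) by rewrite /B'; case: ifP.
have := driven_process_future (ltnW jn) mD mB'.
rewrite future_split// /B' eqxx big_ltn// eqxx.
have -> : future j.+1 (fun i => if i == j then B else setT) = setT.
  apply/seteqP; split => // w _ i /= /andP[ji _]; by rewrite gtn_eqF.
rewrite setIT => ->; congr (_ * _)%E; rewrite [X in (_ * X)%E]big1_seq ?mule1//.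
move=> i /andP[_]; rewrite mem_index_iota => /andP[ji _].
by rewrite gtn_eqF// preimage_setT probability_setT.
Qed.

End driven_process.

(** * Integration against a density *)

Section density.
Context d (T : measurableType d) (R : realType).
Variables (mu nu : {measure set T -> \bar R}) (p : T -> R).
Hypotheses (mp : measurable_fun setT p) (p0 : forall x, 0 <= p x)
  (nuE : forall A, measurable A -> nu A = (\int[mu]_(x in A) (p x)%:E)%E).
Local Open Scope ereal_scope.

Import HBNNSimple.

Let integral_density_nnsfun (h : {nnsfun T >-> R}) :
  \int[nu]_x (h x)%:E = \int[mu]_x ((h x)%:E * (p x)%:E).
Proof.
under eq_integral do rewrite fimfunE -fsumEFin//.
rewrite ge0_integral_fsum//; last 2 first.
- by move=> r; apply/measurable_EFinP; exact: measurable_funM.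
- by move=> r x _; exact: nnfun_muleindic_ge0.
under [RHS]eq_integral.
  move=> x _; rewrite fimfunE -fsumEFin// ge0_mule_fsuml; last first.
    by move=> r; exact: nnfun_muleindic_ge0.
  over.
rewrite [RHS]ge0_integral_fsum//; last 2 first.
- move=> r; apply: emeasurable_funM; last exact/measurable_EFinP.
  by apply/measurable_EFinP; exact: measurable_funM.
- by move=> r x _; rewrite mule_ge0 ?lee_fin ?fun_ge0//; exact: nnfun_muleindic_ge0.
apply: eq_fsbigr => r; rewrite inE => -[t _ <-].
have mh : measurable (h @^-1` [set h t]) by exact: measurable_sfunP.
under eq_integral do rewrite EFinM.
under [RHS]eq_integral do rewrite EFinM -muleA.
rewrite ge0_integralZl//; last 2 first.
- by apply/measurable_EFinP.
- by rewrite lee_fin fun_ge0.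
rewrite [RHS]ge0_integralZl//; last 3 first.
- by apply: emeasurable_funM; apply/measurable_EFinP.
- by move=> x _; rewrite mule_ge0 ?lee_fin ?fun_ge0.
- by rewrite lee_fin fun_ge0.
congr (_ * _); rewrite integral_indic// setIT nuE// integral_mkcond/=.
by apply: eq_integral => x _; rewrite epatch_indic muleC.
Qed.

(** By monotone approximation by simple functions, for which this is the
    hypothesis on [nu]. *)
Lemma ge0_integral_density (f : T -> \bar R) :
  measurable_fun setT f -> (forall x, 0 <= f x) ->
  \int[nu]_x f x = \int[mu]_x (f x * (p x)%:E).
Proof.
move=> mf f0; pose h := nnsfun_approx measurableT mf.
have fE x : f x = lim ((h n x)%:E @[n --> \oo]).
  by apply/esym/cvg_lim => //; exact: cvg_nnsfun_approx.
transitivity (lim (\int[nu]_x (h n x)%:E @[n --> \oo])).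
  rewrite -monotone_convergence//.
  - exact: eq_integral.
  - by move=> n; exact/measurable_EFinP.
  - by move=> n x _; rewrite lee_fin.
  - by move=> x _ m n mn; rewrite lee_fin; exact/lefP/nd_nnsfun_approx.
under eq_fun do rewrite integral_density_nnsfun.
rewrite -monotone_convergence//.
- apply: eq_integral => x _; apply/cvg_lim => //; apply: cvgeZr => //.
  exact: cvg_nnsfun_approx.
- by move=> n; apply: emeasurable_funM; exact/measurable_EFinP.
- by move=> n x _; rewrite mule_ge0 ?lee_fin ?fun_ge0.
- move=> x _ m n mn; rewrite lee_wpmul2r ?lee_fin//; exact/lefP/nd_nnsfun_approx.
Qed.

End density.

Section translation.
Context (R : realType).
Local Notation mu := (@lebesgue_measure R).

Lemma ge0_integral_translation (f : R -> \bar R) (a : R) :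
  measurable_fun setT f -> (forall x, (0 <= f x)%E) ->
  (\int[mu]_x f (x + a)%R = \int[mu]_x f x)%E.
Proof.
move=> mf f0.
have mta : measurable_fun setT (fun x : measurableTypeR R => (x + a)%R : measurableTypeR R).
  have : measurable_fun setT (fun x : R => x + a) by exact: measurable_funD.
  exact.
transitivity (\int[pushforward mu (fun x : measurableTypeR R => (x + a)%R : measurableTypeR R)]_x f x)%E.
  by rewrite ge0_integral_pushforward// preimage_setT.
pose ta : {mfun measurableTypeR R >-> measurableTypeR R} :=
  HB.pack (fun x : measurableTypeR R => (x + a)%R : measurableTypeR R) (isMeasurableFun.Build _ _ _ _ _ mta).
apply: (@eq_measure_integral _ _ _ _ mu (pushforward mu ta)) => A mA _.
apply/esym/lebesgue_measure_unique => //= _ [[u v]] _ <-.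
rewrite /pushforward/= (_ : _ @^-1` _ = `]u - a, v - a]%classic).
  rewrite !lebesgue_measure_itv/= !lte_fin ltrD2r.
  by case: ifPn => // _; rewrite -!EFinB; congr EFin; lra.
by apply/seteqP; split => x /=; rewrite !in_itv/= => /andP[? ?]; apply/andP; split; lra.
Qed.

End translation.

Lemma measurable_event d (T : measurableType d) (b : T -> bool) :
  measurable_fun setT b -> measurable [set w | b w].
Proof.
move=> mb; rewrite -[X in measurable X]setTI.
by apply: mb => //; exact: (@measurable _ _ [set true]).
Qed.

Lemma integral_indicator d (T : measurableType d) (R : realType)
    (P : {measure set T -> \bar R}) (b : T -> bool) : measurable_fun setT b ->
  (\int[P]_w (if b w then 1 else 0)%:E = P [set w | b w])%E.
Proof.
move=> mb; have mB := measurable_event mb.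
transitivity (\int[P]_w (\1_[set w | b w] w)%:E)%E; last first.
  by rewrite integral_indic// setIT.
apply: eq_integral => w _; rewrite indicE; congr EFin.
by case: ifPn => bw; [rewrite mem_set|rewrite memNset//; apply/negP].
Qed.

(** * Optional stopping for the two-barrier walk *)

Section random_walk_barriers.
Context d (T : measurableType d) (R : realType).
Variables (P : probability T R) (n : nat) (Z : nat -> T -> R).
Hypotheses (mZ : forall i, measurable_fun setT (Z i)) (indZ : independent_sequence P n Z).

Local Notation path w := (fun i => Z i w).

Lemma measurable_walk_step :
  measurable_fun [set: (R * (R * R)) * R] (fun x => walk_step x.1 x.2).
Proof.
have m1 : measurable_fun [set: (R * (R * R)) * R] (fun x => x.1.1 + x.2).
  apply: measurable_funD; last exact: measurable_snd.
  exact: (measurableT_comp measurable_fst measurable_fst).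
have m2 : measurable_fun [set: (R * (R * R)) * R] (fun x => x.1.2.1).
  apply: (measurableT_comp measurable_fst).
  exact: (measurableT_comp measurable_snd measurable_fst).
have m3 : measurable_fun [set: (R * (R * R)) * R] (fun x => x.1.2.2).
  apply: (measurableT_comp measurable_snd).
  exact: (measurableT_comp measurable_snd measurable_fst).
apply: measurable_fun_pair => //; apply: measurable_fun_pair.
  apply: measurable_maxr => //; apply: measurable_minr => //.
  exact: measurable_funN.
apply: measurable_minr => //; apply: measurable_maxr => //.
exact: measurable_funB.
Qed.

Lemma walk_state_driven j w : walk_state (path w) j =
  driven_process Z (0, (0, 1)) (fun x => walk_step x.1 x.2) j w.
Proof. by elim: j => [|j IH] //=; rewrite IH. Qed.

Lemma measurable_walk_state j : measurable_fun setT (fun w => walk_state (path w) j).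
Proof.
rewrite (_ : (fun _ => _) =
  driven_process Z (0, (0, 1)) (fun x => walk_step x.1 x.2) j); last first.
  by apply/funext => w; exact: walk_state_driven.
exact: (measurable_driven_process _ mZ measurable_walk_step).
Qed.

Lemma walk_state_independent j D B : (j < n)%N ->
  measurable (D : set (R * (R * R))) -> measurable B ->
  P ((fun w => walk_state (path w) j) @^-1` D `&` Z j @^-1` B) =
  (P ((fun w => walk_state (path w) j) @^-1` D) * P (Z j @^-1` B))%E.
Proof.
move=> jn mD mB; rewrite (_ : (fun _ => _) =
  driven_process Z (0, (0, 1)) (fun x => walk_step x.1 x.2) j); last first.
  by apply/funext => w; exact: walk_state_driven.
exact: (driven_process_independent _ mZ measurable_walk_step indZ).
Qed.

Lemma measurable_walk_lo j : measurable_fun setT (fun w => walk_lo (path w) j).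
Proof.
apply: (measurableT_comp measurable_fst).
exact: (measurableT_comp measurable_snd (measurable_walk_state j)).
Qed.

Lemma measurable_walk_hi j : measurable_fun setT (fun w => walk_hi (path w) j).
Proof.
apply: (measurableT_comp measurable_snd).
exact: (measurableT_comp measurable_snd (measurable_walk_state j)).
Qed.

Lemma measurable_walk_undecided v j :
  measurable_fun setT (fun w => walk_undecided (path w) v j).
Proof.
apply: measurable_and; apply: measurable_fun_ltr => //.
- exact: measurable_walk_lo.
- exact: measurable_walk_hi.
Qed.

Variable M : R.
Hypotheses
  (symZ : forall j, (j < n)%N -> (\int[P]_w (Num.max (Z j w) 0)%:E =
                                  \int[P]_w (Num.max (- Z j w) 0)%:E)%E)
  (m4Z : forall j, (j < n)%N -> (\int[P]_w (Z j w ^+ 4)%:E <= M%:E)%E).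

Let integrable4 j : (j < n)%N -> P.-integrable setT (fun w => (Z j w ^+ 4)%:E).
Proof.
move=> jn; apply/integrableP; split.
  by apply/measurable_EFinP; exact: measurable_funX.
under eq_integral do rewrite gee0_abs ?lee_fin ?exprn_even_ge0//.
by rewrite (le_lt_trans (m4Z jn))// ltry.
Qed.

Let integrable1 j : (j < n)%N -> P.-integrable setT (fun w => (Z j w)%:E).
Proof.
move=> jn; apply: (@le_integrable _ _ _ _ _ _ _ (fun w => (1 + Z j w ^+ 4)%:E)) => //.
- exact/measurable_EFinP.
- move=> w _; rewrite /= lee_fin; have := ler_pow4 (Z j w) (@ltr01 R).
  by rewrite expr1n divr1 => /le_trans; apply; exact: ler_norm.
- under eq_fun do rewrite EFinD.
  apply: integrableD => //; last exact: integrable4.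
  exact: finite_measure_integrable_cst.
Qed.

Let stopped_increment v j w := if walk_undecided (path w) v j then Z j w else 0.

Let measurable_stopped_increment v j : measurable_fun setT (stopped_increment v j).
Proof.
by apply: measurable_fun_ifT => //; exact: measurable_walk_undecided.
Qed.

Let integrable_stopped_increment v j : (j < n)%N ->
  P.-integrable setT (fun w => (stopped_increment v j w)%:E).
Proof.
move=> jn; apply: le_integrable (integrable1 jn) => //.
  exact/measurable_EFinP.
by move=> w _; rewrite /= lee_fin /stopped_increment; case: ifP; rewrite ?normr0.
Qed.

(** Whether [v] is still undecided at time [j] depends only on the state at time
    [j], which is independent of [Z j]. *)
Let integral_undecided (f : R -> R) v j : (j < n)%N -> measurable_fun setT f ->
  (forall x, 0 <= f x) ->
  (\int[P]_w (if walk_undecided (path w) v j then f (Z j w) else 0)%:E =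
   P [set w | walk_undecided (path w) v j] * \int[P]_w (f (Z j w))%:E)%E.
Proof.
move=> jn mf f0.
pose g (x : (R * (R * R)) * R) := (if (x.1.2.1 < v) && (v < x.1.2.2) then f x.2 else 0)%:E.
have mg : measurable_fun setT g.
  apply/measurable_EFinP; apply: measurable_fun_ifT => //.
    apply: measurable_and; apply: measurable_fun_ltr => //.
      apply: (measurableT_comp measurable_fst).
      exact: (measurableT_comp measurable_snd measurable_fst).
    apply: (measurableT_comp measurable_snd).
    exact: (measurableT_comp measurable_snd measurable_fst).
  exact: (measurableT_comp mf measurable_snd).
transitivity (\int[P]_w g (walk_state (path w) j, Z j w))%E; first by [].
rewrite (independent_pair_integral (measurable_walk_state j) (mZ j))//;
  last 2 first.
- by move=> D B; exact: walk_state_independent.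
- by move=> x; rewrite lee_fin; case: ifP.
rewrite -integral_indicator; last exact: measurable_walk_undecided.
rewrite muleC -ge0_integralZl//; last 3 first.
- apply/measurable_EFinP; apply: measurable_fun_ifT => //.
  exact: measurable_walk_undecided.
- by move=> w _; rewrite lee_fin; case: ifP.
- by apply: integral_ge0 => w _; rewrite lee_fin.
apply: eq_integral => w _.
have gE y : g (walk_state (path w) j, y) =
  (if walk_undecided (path w) v j then f y else 0)%:E by [].
under eq_integral do rewrite gE.
case: (walk_undecided (path w) v j); last by rewrite integral0 mule0.
by rewrite mule1.
Qed.

Let integral_stopped_increment v j : (j < n)%N ->
  (\int[P]_w (stopped_increment v j w)%:E = 0)%E.
Proof.
move=> jn.
have mu := measurable_walk_undecided v j.
(* The positive and negative parts, stopped, have the same integral. *)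
pose f1 w := if walk_undecided (path w) v j then Num.max (Z j w) 0 else 0.
pose f2 w := if walk_undecided (path w) v j then Num.max (- Z j w) 0 else 0.
have mf1 : measurable_fun setT f1.
  by apply: measurable_fun_ifT => //; apply: measurable_maxr.
have mf2 : measurable_fun setT f2.
  by apply: measurable_fun_ifT => //; apply: measurable_maxr => //; exact: measurable_funN.
have i1 : P.-integrable setT (fun w => (f1 w)%:E).
  apply: le_integrable (integrable1 jn) => //; first exact/measurable_EFinP.
  move=> w _; rewrite /= lee_fin /f1; case: ifP; rewrite ?normr0// => _.
  by rewrite /Num.max; case: ifPn; rewrite ?normr0.
have i2 : P.-integrable setT (fun w => (f2 w)%:E).
  apply: le_integrable (integrable1 jn) => //; first exact/measurable_EFinP.
  move=> w _; rewrite /= lee_fin /f2; case: ifP; rewrite ?normr0// => _.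
  by rewrite /Num.max; case: ifPn; rewrite ?normr0 ?normrN.
transitivity (\int[P]_w ((f1 w)%:E - (f2 w)%:E))%E.
  apply: eq_integral => w _; rewrite -EFinB; congr EFin.
  rewrite /f1 /f2 /stopped_increment; case: ifP => _; last by rewrite subr0.
  by rewrite /Num.max; do ! case: ifPn; rewrite -?leNgt; lra.
rewrite integralB_EFin//.
rewrite (integral_undecided (f := fun x => Num.max x 0))//; last 2 first.
- exact: measurable_maxr.
- by move=> x; rewrite le_max lexx orbT.
rewrite (integral_undecided (f := fun x => Num.max (- x) 0))//; last 2 first.
- by apply: measurable_maxr => //; exact: measurable_funN.
- by move=> x; rewrite le_max lexx orbT.
rewrite -symZ// subee// fin_numM ?fin_num_measure//.
  exact: measurable_event.
apply: integrable_fin_num => //; apply: le_integrable (integrable1 jn) => //.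
  by apply/measurable_EFinP; exact: measurable_maxr.
by move=> w _; rewrite /= lee_fin /Num.max; case: ifPn; rewrite ?normr0.
Qed.

(** Optional stopping.  The positive and negative parts of the increments have the
    same mean, so each stopped increment has mean [0]. *)
Lemma integral_walk_stopped v j : (j <= n)%N ->
  P.-integrable setT (fun w => (walk_stopped (path w) v j)%:E) /\
  (\int[P]_w (walk_stopped (path w) v j)%:E = 0)%E.
Proof.
elim: j => [_|j IH jn] /=; first by split; [exact: integrable0|exact: integral0].
have [iIH eIH] := IH (ltnW jn); split.
  under eq_fun do rewrite EFinD.
  by apply: integrableD => //; exact: integrable_stopped_increment.
under eq_integral do rewrite EFinD.
by rewrite integralD_EFin ?eIH ?integral_stopped_increment ?adde0//;
  exact: integrable_stopped_increment.
Qed.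

Let integrable_overshoot e : P.-integrable setT (fun w => (overshoot (path w) e n)%:E).
Proof.
under eq_fun do rewrite /overshoot EFinD big_mkord mulrC EFinM -sumEFin.
apply: integrableD => //; first exact: finite_measure_integrable_cst.
apply: integrableZl => //; apply: integrable_sum => // i _.
exact: integrable4.
Qed.

Lemma integral_overshoot e : 0 < e ->
  (\int[P]_w (overshoot (path w) e n)%:E <= (e + n%:R * M / e ^+ 3)%:E)%E.
Proof.
move=> e0; under eq_integral do rewrite /overshoot EFinD big_mkord mulrC EFinM -sumEFin.
have ec : P.-integrable setT (fun=> e%:E) by exact: finite_measure_integrable_cst.
rewrite integralD//; last first.
  by apply: integrableZl => //; apply: integrable_sum => // i _; exact: integrable4.
rewrite integral_cst//= probability_setT mule1 integralZl//; last first.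
  by apply: integrable_sum => // i _; exact: integrable4.
rewrite integral_sum//; last by move=> i; exact: integrable4.
rewrite EFinD leeD2l// mulrC EFinM lee_wpmul2l ?lee_fin ?invr_ge0 ?exprn_ge0 ?(ltW e0)//.
rewrite (le_trans (lee_sum _ (fun i _ => m4Z (ltn_ord i))))//.
by rewrite sumEFin sumr_const card_ord mulr_natl.
Qed.

Lemma walk_top_probability v e : 0 < e -> 0 < v < 1 ->
  (P [set w | ((walk_lo (path w) n < v) && (walk_hi (path w) n <= v))%R]
   <= (v + (e + n%:R * M / e ^+ 3))%:E)%E.
Proof.
move=> e0 v01.
have mb : measurable_fun setT
    (fun w => (walk_lo (path w) n < v) && (walk_hi (path w) n <= v)).
  apply: measurable_and; first by apply: measurable_fun_ltr => //; exact: measurable_walk_lo.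
  by apply: measurable_fun_ler => //; exact: measurable_walk_hi.
rewrite -integral_indicator//.
have [istop estop] := integral_walk_stopped v (leqnn n).
have iv : P.-integrable setT (fun=> v%:E) by exact: finite_measure_integrable_cst.
have io := integrable_overshoot e.
apply: (@le_trans _ _ (\int[P]_w ((walk_stopped (path w) v n)%:E +
   (v%:E + (overshoot (path w) e n)%:E)))%E).
  apply: le_integral => //.
  - apply: le_integrable (finite_measure_integrable_cst P 1 measurableT) => //.
      apply/measurable_EFinP; exact: measurable_fun_ifT.
    by move=> w _; rewrite /= lee_fin; case: ifP; rewrite ?normr0 ?normr1.
  - by apply: integrableD => //; exact: integrableD.
  - by move=> w _; rewrite -!EFinD lee_fin addrA; exact: walk_top_le.
rewrite integralD//; last exact: integrableD.
rewrite estop add0e integralD// integral_cst//= probability_setT mule1.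
by rewrite EFinD leeD2l// integral_overshoot.
Qed.

(** Almost gambler's ruin: a starting point [v] is decided by the upper barrier with
    probability at most about [v] and undecided only when the walk ends within a
    unit distance of its start, so it is decided by the lower barrier otherwise. *)
Lemma walk_lo_probability v e : 0 < e -> 0 < v < 1 ->
  ((1 - v)%:E <= P [set w | (v <= walk_lo (path w) n)%R] +
     P [set w | (`|walk_pos (path w) n| < 1)%R] + (e + n%:R * M / e ^+ 3)%:E)%E.
Proof.
move=> e0 v01.
have mlo := measurable_walk_lo n; have mhi := measurable_walk_hi n.
have mpos : measurable_fun setT (fun w => walk_pos (path w) n).
  exact: (measurableT_comp measurable_fst (measurable_walk_state n)).
pose A1 := [set w | v <= walk_lo (path w) n].
pose A2 := [set w | `|walk_pos (path w) n| < 1].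
pose A3 := [set w | (walk_lo (path w) n < v) && (walk_hi (path w) n <= v)].
have mA1 : measurable A1 by apply: measurable_event; exact: measurable_fun_ler.
have mA2 : measurable A2.
  by apply: measurable_event; apply: measurable_fun_ltr => //; exact: measurableT_comp.
have mA3 : measurable A3.
  by apply: measurable_event; apply: measurable_and; [exact: measurable_fun_ltr|exact: measurable_fun_ler].
have cover : (1 <= P A1 + P A2 + P A3)%E.
  rewrite -(@probability_setT _ _ _ P).
  apply: (@le_trans _ _ (P (A1 `|` A2 `|` A3))); last first.
    rewrite (le_trans (measureU2 _ _ _))//; first exact: measurableU.
    by rewrite leeD2r// measureU2.
  apply: le_measure; rewrite ?inE//; first by do 2 apply: measurableU => //.
  move=> w _; have [lov|vlo] := ltP (walk_lo (path w) n) v; last by left; left.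
  have [hiv|vhi] := leP (walk_hi (path w) n) v; first by right; rewrite /A3/= lov.
  have /(walk_undecided_range v01) : walk_undecided (path w) v n by rewrite /walk_undecided lov.
  by left; right; rewrite /A2/= ltr_norml; lra.
have A3le := walk_top_probability e0 v01.
have fin A : measurable A -> P A \is a fin_num by move=> ?; rewrite fin_num_measure.
rewrite -/A1 -/A2; rewrite -/A3 in A3le.
move: cover A3le.
rewrite -(fineK (fin _ mA1)) -(fineK (fin _ mA2)) -(fineK (fin _ mA3)).
by rewrite -!EFinD !lee_fin; lra.
Qed.

End random_walk_barriers.

Lemma independent_sequence_comp d (T : measurableType d) (R : realType)
    (P : probability T R) n (Z : nat -> T -> R) (h : R -> R) :
  measurable_fun setT h -> independent_sequence P n Z ->
  independent_sequence P n (fun i w => h (Z i w)).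
Proof.
move=> mh indZ B mB; apply: (indZ (fun i => h @^-1` B i)) => i.
by rewrite -[X in measurable X]setTI; exact: mh.
Qed.

Lemma independent_sequence_take d (T : measurableType d) (R : realType)
    (P : probability T R) n (Z : nat -> T -> R) :
  independent_sequence P n.+1 Z -> independent_sequence P n Z.
Proof.
move=> indZ B mB; pose B' i := if i == n then setT else B i.
have mB' i : measurable (B' i) by rewrite /B'; case: ifP.
have := indZ B' mB'; rewrite big_nat_recr//=.
have -> : B' n = setT by rewrite /B' eqxx.
rewrite preimage_setT probability_setT mule1.
rewrite (_ : \bigcap_(i in `I_n.+1) _ = \bigcap_(i in `I_n) (Z i @^-1` B i)).
  move=> ->; apply: eq_big_nat => i /andP[_ ni]; by rewrite /B' ltn_eqF.
apply/seteqP; split=> w H i /= ni.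
  by have := H i (ltnW ni); rewrite /B' ltn_eqF.
rewrite /B'; case: eqP => // /eqP ne; apply: H => /=.
by rewrite ltn_neqAle ne.
Qed.

(** [walk_lo_probability] for the opposite walk. *)
Lemma walk_hi_probability d (T : measurableType d) (R : realType)
    (P : probability T R) n (Z : nat -> T -> R) (M v e : R) :
  (forall i, measurable_fun setT (Z i)) -> independent_sequence P n Z ->
  (forall j, (j < n)%N -> (\int[P]_w (Num.max (Z j w) 0)%:E =
                           \int[P]_w (Num.max (- Z j w) 0)%:E)%E) ->
  (forall j, (j < n)%N -> (\int[P]_w (Z j w ^+ 4)%:E <= M%:E)%E) ->
  0 < e -> 0 < v < 1 ->
  (v%:E <= P [set w | (walk_hi (fun i => Z i w) n <= v)%R] +
     P [set w | (`|walk_pos (fun i => Z i w) n| < 1)%R] + (e + n%:R * M / e ^+ 3)%:E)%E.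
Proof.
move=> mZ indZ symZ m4Z e0 v01.
have mN (i : nat) : measurable_fun setT (fun w => - Z i w) by exact: measurable_funN.
have indN : independent_sequence P n (fun i w => - Z i w).
  by apply: (independent_sequence_comp (h := -%R)).
have symN j : (j < n)%N -> (\int[P]_w (Num.max (- Z j w) 0)%:E =
    \int[P]_w (Num.max (- - Z j w) 0)%:E)%E.
  by move=> jn; under [RHS]eq_integral do rewrite opprK; rewrite symZ.
have m4N j : (j < n)%N -> (\int[P]_w ((- Z j w) ^+ 4)%:E <= M%:E)%E.
  move=> jn; under eq_integral do rewrite -mulN1r exprMn -signr_odd expr0 mul1r.
  exact: m4Z.
have v01' : 0 < 1 - v < 1 by lra.
have := walk_lo_probability mN indN symN m4N e0 v01'.
rewrite subKr; under eq_set do rewrite /walk_lo walk_stateN/= lerD2l lerN2.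
by under [X in _ + P X]eq_set do rewrite /walk_pos walk_stateN/= normrN.
Qed.

(** * Bounds on the normal density *)

Section law_density.
Context d (T : measurableType d) (R : realType).
Variables (P : probability T R) (Z : T -> R) (p : R -> R).
Hypotheses (mZ : measurable_fun setT Z) (mp : measurable_fun setT p)
  (p0 : forall x, 0 <= p x)
  (Zp : forall A : set R, measurable A ->
    P (Z @^-1` A) = (\int[lebesgue_measure]_(x in A) (p x)%:E)%E).

Lemma integral_law_density (f : R -> \bar R) :
  measurable_fun setT f -> (forall x, (0 <= f x)%E) ->
  (\int[P]_w f (Z w) = \int[lebesgue_measure]_x (f x * (p x)%:E))%E.
Proof.
move=> mf f0.
have mZ' : measurable_fun setT (Z : T -> measurableTypeR R) by exact: mZ.
pose Zm : {mfun T >-> measurableTypeR R} := HB.pack (Z : T -> measurableTypeR R)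
  (isMeasurableFun.Build _ _ _ _ _ mZ').
transitivity (\int[pushforward P Zm]_x f x)%E.
  by rewrite ge0_integral_pushforward// preimage_setT.
exact: (@ge0_integral_density _ _ _ lebesgue_measure (pushforward P Zm) p).
Qed.

End law_density.

Lemma ge0_integral_reflection (R : realType) (f : R -> \bar R) :
  measurable_fun setT f -> (forall x, (0 <= f x)%E) ->
  (\int[lebesgue_measure]_x f (- x)%R = \int[lebesgue_measure]_x f x)%E.
Proof.
move=> mf f0.
transitivity (\int[pushforward lebesgue_measure (-%R : measurableTypeR R -> measurableTypeR R)]_x f x)%E.
  by rewrite ge0_integral_pushforward// preimage_setT.
by apply: eq_measure_integral => A mA _; exact: lebesgue_measureN.
Qed.

Section normal_density_bounds.
Context (R : realType) (s : R).
Hypothesis s0 : 0 < s.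
Local Notation p := (normal_pdf 0 s).
Local Notation mu := (@lebesgue_measure R).

Let sne0 : s != 0. Proof. by rewrite gt_eqF. Qed.

Lemma normal_pdf0E x : p x = normal_peak s * expR (- (x ^+ 2 / (s ^+ 2 *+ 2))).
Proof. by rewrite normal_pdfE// /normal_fun subr0 mulNr. Qed.

Lemma normal_pdf0N x : p (- x) = p x.
Proof. by rewrite !normal_pdf0E sqrrN. Qed.

(** The constant absorbs the fourth power into a normal density with twice the
    standard deviation: with [y = 3 x^2 / (8 s^2)], one has
    [x^4 = (64 / 9) y^2 s^4] and [y^2 <= 2 exp y], hence
    [x^4 exp (- y) <= 15 s^4], and the two peaks differ by a factor [2]. *)
Lemma pow4_normal_pdf x : x ^+ 4 * p x <= 30 * s ^+ 4 * normal_pdf 0 (2 * s) x.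
Proof.
have s2ne0 : 2 * s != 0 by rewrite mulf_neq0.
rewrite normal_pdf0E (normal_pdfE _ s2ne0) /normal_fun subr0.
have -> : normal_peak s = 2 * normal_peak (2 * s).
  rewrite /normal_peak.
  have -> : (2 * s) ^+ 2 * pi *+ 2 = 2 ^+ 2 * (s ^+ 2 * pi *+ 2) :> R by ring.
  by rewrite (sqrtrM _ (sqr_ge0 _)) sqrtr_sqr ger0_norm// invfM mulrA divff// mul1r.
set k := normal_peak (2 * s).
have k0 : 0 < k by exact: normal_peak_gt0.
pose y := 3 * x ^+ 2 / (8 * s ^+ 2).
have s20 : 0 < s ^+ 2 by rewrite exprn_gt0.
have x20 : 0 <= x ^+ 2 by rewrite sqr_ge0.
have y0 : 0 <= y by rewrite divr_ge0// mulr_ge0// ltW.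
rewrite (_ : - (x ^+ 2 / (s ^+ 2 *+ 2)) = - y + (- x ^+ 2 / ((2 * s) ^+ 2 *+ 2))); last first.
  by rewrite /y; field.
rewrite expRD; set E := expR (_ / _).
have E0 : 0 < E by exact: expR_gt0.
suff : x ^+ 4 * expR (- y) <= 15 * s ^+ 4.
  move=> H; have := ler_wpM2r (mulr_ge0 (ltW k0) (ltW E0)) H; lra.
rewrite expRN ler_pdivrMr ?expR_gt0//.
have := expR_ge1Dxn 1 y0; have -> : (2`!%:R : R) = 2 by [].
have -> : x ^+ 4 = y ^+ 2 * (64 / 9) * s ^+ 4.
  by rewrite /y; field.
move=> H.
have s4 : 0 < s ^+ 4 by rewrite exprn_gt0.
have : y ^+ 2 * (64 / 9) <= 15 * expR y by have := sqr_ge0 y; lra.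
by move=> /(ler_wpM2r (ltW s4)); lra.
Qed.

Lemma integral_pow4_normal_pdf :
  (\int[mu]_x ((x ^+ 4)%:E * (p x)%:E) <= (30 * s ^+ 4)%:E)%E.
Proof.
have s4 : 0 <= 30 * s ^+ 4 by rewrite mulr_ge0// exprn_even_ge0.
apply: (@le_trans _ _ (\int[mu]_x ((30 * s ^+ 4)%:E * (normal_pdf 0 (2 * s) x)%:E))%E).
  apply: ge0_le_integral => //.
  - by move=> x _; rewrite mule_ge0 ?lee_fin ?normal_pdf_ge0 ?exprn_even_ge0.
  - apply/measurable_EFinP; apply: measurable_funM; first exact: measurable_funX.
    exact: measurable_normal_pdf.
  - apply/measurable_EFinP; apply: measurable_funM => //.
    exact: measurable_normal_pdf.
  - by move=> x _; rewrite -!EFinM lee_fin; exact: pow4_normal_pdf.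
rewrite ge0_integralZl//.
- by rewrite integral_normal_pdf mule1.
- by apply/measurable_EFinP; exact: measurable_normal_pdf.
- by move=> x _; rewrite lee_fin normal_pdf_ge0.
Qed.

Lemma integral_normal_pdf_small (r : R) : 0 <= r ->
  (\int[mu]_(x in `](- r)%R, r[) (p x)%:E <= (2 * r * normal_peak s)%:E)%E.
Proof.
move=> r0; apply: (@le_trans _ _ (\int[mu]_(x in `](- r)%R, r[) (cst (normal_peak s)%:E x))%E).
  apply: ge0_le_integral => //.
  - by move=> x _; rewrite lee_fin normal_pdf_ge0.
  - by apply/measurable_EFinP/measurable_funTS; exact: measurable_normal_pdf.
  - by move=> x _; rewrite lee_fin normal_pdf_ub.
rewrite integral_cst//= lebesgue_measure_itv/= lte_fin.
case: ifPn => _; last by rewrite mule0 lee_fin mulr_ge0 ?normal_peak_ge0// mulr_ge0.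
by rewrite -EFinB -EFinM lee_fin; lra.
Qed.

End normal_density_bounds.

(** * Equidistribution of a normal variable modulo a small step *)

Section periodic.
Context (R : realType).
Local Notation mu := (@lebesgue_measure R).
Implicit Types (g : R -> R) (y v : R).

Definition fractional y : R := y - (Num.floor y)%:~R.

(** The extension by zero from the unit interval, which makes integrals over the
    unit interval integrals over the whole line and translations immediate. *)
Definition on_unit g v : R := if 0 <= v < 1 then g v else 0.

Lemma fractional_itv y : 0 <= fractional y < 1.
Proof. by rewrite /fractional; have := floor_itv y; rewrite intrD; lra. Qed.

Lemma fractional_def y (m : int) : 0 <= y - m%:~R < 1 -> fractional y = y - m%:~R.
Proof.
by move=> H; rewrite /fractional (@floor_def _ y m)// intrD; move: H; lra.
Qed.

Lemma fractionalD y v : 0 <= v < 1 ->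
  fractional (y + v) = if fractional y + v < 1 then fractional y + v else fractional y + v - 1.
Proof.
move=> v01; have f01 := fractional_itv y.
set m := Num.floor y; have yE : fractional y = y - m%:~R by [].
rewrite yE in f01 *; case: ltP => [lt1|le1].
  have H : 0 <= y + v - m%:~R < 1 by lra.
  by rewrite (fractional_def H); lra.
have H : 0 <= y + v - (m + 1)%:~R < 1 by rewrite intrD; lra.
by rewrite (fractional_def H) intrD; lra.
Qed.

Lemma measurable_fractional : measurable_fun setT fractional.
Proof.
apply: measurable_funB => //; apply: nondecreasing_measurable => //.
by move=> x y xy; rewrite ler_int le_floor.
Qed.

Lemma measurable_on_itv g a b : measurable_fun setT g ->
  measurable_fun setT (fun v => if a <= v < b then g v else 0).
Proof.
move=> mg; apply: measurable_fun_ifT => //; apply: measurable_and.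
  exact: measurable_fun_ler.
exact: measurable_fun_ltr.
Qed.

Lemma measurable_on_unit g : measurable_fun setT g -> measurable_fun setT (on_unit g).
Proof. exact: measurable_on_itv. Qed.

Lemma integral_on_unit1 : (\int[mu]_v (on_unit (fun=> 1) v)%:E = 1)%E.
Proof.
rewrite integral_indicator.
  transitivity (mu `[0%R, 1%R[%classic).
    by congr (mu _); apply/seteqP; split => v /=; rewrite in_itv.
  by rewrite lebesgue_measure_itv/= lte01 -EFinB subr0.
by apply: measurable_and; [exact: measurable_fun_ler|exact: measurable_fun_ltr].
Qed.

(** The interval is cut at the point where [y + v] crosses an integer, and each
    piece is translated. *)
Lemma integral_on_unit_fractional g y : measurable_fun setT g -> (forall v, 0 <= g v) ->
  (\int[mu]_v (on_unit (fun v => g (fractional (y + v))) v)%:E =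
   \int[mu]_v (on_unit g v)%:E)%E.
Proof.
move=> mg g0; have /andP[f0 f1] := fractional_itv y; set r := fractional y in f0 f1 *.
pose g1 v := if r <= v < 1 then g v else 0.
pose g2 v := if 0 <= v < r then g v else 0.
have mg1 : measurable_fun setT g1 by exact: measurable_on_itv.
have mg2 : measurable_fun setT g2 by exact: measurable_on_itv.
have g10 v : 0 <= g1 v by rewrite /g1; case: ifP.
have g20 v : 0 <= g2 v by rewrite /g2; case: ifP.
transitivity (\int[mu]_v ((g1 (v + r))%:E + (g2 (v + (r - 1)))%:E))%E.
  apply: eq_integral => v _; rewrite -EFinD; congr EFin; rewrite /on_unit /g1 /g2.
  case: ifPn => [v01|nv].
    rewrite fractionalD// -/r; case: ltP => [lt1|le1].
      rewrite ifT; last by lra.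
      rewrite ifF; last by apply/negbTE/negP; lra.
      by rewrite addr0 addrC.
    rewrite ifF; last by apply/negbTE/negP; lra.
    rewrite ifT; last by lra.
    by rewrite add0r addrA [r + v]addrC.
  rewrite ifF; last by apply: contraNF nv; lra.
  rewrite ifF; last by apply: contraNF nv; lra.
  by rewrite addr0.
have mt a : measurable_fun setT (fun x : R => x + a) by exact: measurable_funD.
rewrite ge0_integralD//; last 4 first.
- by move=> v _; rewrite lee_fin.
- by apply/measurable_EFinP; exact: (measurableT_comp mg1 (mt r)).
- by move=> v _; rewrite lee_fin.
- by apply/measurable_EFinP; exact: (measurableT_comp mg2 (mt (r - 1))).
rewrite (@ge0_integral_translation _ (fun v => (g1 v)%:E))//; last exact/measurable_EFinP.
rewrite (@ge0_integral_translation _ (fun v => (g2 v)%:E))//; last exact/measurable_EFinP.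
rewrite -ge0_integralD//; last 4 first.
- by move=> v _; rewrite lee_fin.
- exact/measurable_EFinP.
- by move=> v _; rewrite lee_fin.
- exact/measurable_EFinP.
apply: eq_integral => v _; rewrite -EFinD; congr EFin; rewrite /g1 /g2 /on_unit.
have [vr|rv] := ltP v r.
  have -> : v < 1 by lra.
  by rewrite /= !andbT add0r.
have -> : 0 <= v by lra.
by rewrite /= addr0.
Qed.

End periodic.

Section equidistribution.
Context (R : realType) (s k : R).
Hypotheses (s0 : 0 < s) (k0 : 0 < k).
Local Notation p := (normal_pdf 0 s).
Local Notation mu := (@lebesgue_measure R).
Let l := k^-1.
Let l0 : 0 < l. Proof. by rewrite invr_gt0. Qed.
Let q (x : R) := p (`|x| + l).

(** An upper bound on the mass lost when the normal density of standard deviation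
    [s] is replaced at each point by its infimum over the ball of radius [1 / k]. *)
Definition equidistribution_error :=
  (2 * k^-1 * (1 + 30 * s ^+ 4) + k^-1 ^+ 2) / (2 * s ^+ 2).

Lemma equidistribution_error_ge0 : 0 <= equidistribution_error.
Proof.
apply: divr_ge0; last by apply: mulr_ge0 => //; exact: sqr_ge0.
apply: addr_ge0; last exact: sqr_ge0.
apply: mulr_ge0; first by apply: mulr_ge0 => //; rewrite invr_ge0 ltW.
by apply: addr_ge0 => //; apply: mulr_ge0 => //; rewrite exprn_even_ge0.
Qed.

Let mp : measurable_fun setT p. Proof. exact: measurable_normal_pdf. Qed.

Let mq : measurable_fun setT q.
Proof. by apply: (measurableT_comp mp); apply: measurable_funD => //; exact: measurableT_comp. Qed.

Let q0 x : 0 <= q x. Proof. exact: normal_pdf_ge0. Qed.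

Let peak0 : 0 < normal_peak s. Proof. by apply: normal_peak_gt0; rewrite gt_eqF. Qed.

(** The density decreases away from [0], so [q] translated by at most [l] stays
    below [p]. *)
Let pdf_shift x v : 0 <= v <= 1 -> q (x - l * v) <= p x.
Proof.
move=> /andP[v0 v1]; rewrite /q !normal_pdf0E// ler_pM2l// ler_expR lerN2.
rewrite ler_pM2r ?invr_gt0 ?mulrn_wgt0 ?exprn_gt0//.
rewrite -real_normK ?num_real// lerXn2r ?nnegrE//.
  by rewrite addr_ge0// ltW.
have -> : x = (x - l * v) + l * v by rewrite subrK.
rewrite [X in _ <= `|X - _| + _](_ : _ = x); last by rewrite subrK.
rewrite (le_trans (ler_normD _ _))// lerD2l ger0_norm; first by rewrite ler_piMr// ltW.
by rewrite mulr_ge0// ltW.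
Qed.

(** The quotient [q x / p x] is [exp (- t)] with
    [t = (2 * l * `|x| + l ^+ 2) / (2 * s ^+ 2)], and [exp (- t) >= 1 - t]. *)
Let pdf_le_q x : p x <= q x + (2 * l * (1 + x ^+ 4) + l ^+ 2) / (2 * s ^+ 2) * p x.
Proof.
have s20 : 0 < 2 * s ^+ 2 by rewrite mulr_gt0// exprn_gt0.
set t := (2 * l * `|x| + l ^+ 2) / (2 * s ^+ 2).
have qE : q x = p x * expR (- t).
  rewrite /q !normal_pdf0E// -[RHS]mulrA -expRD; congr (_ * expR _).
  have -> : (`|x| + l) ^+ 2 = x ^+ 2 + (2 * l * `|x| + l ^+ 2).
    by rewrite -[in x ^+ 2]real_normK ?num_real//; ring.
  by rewrite /t; field; rewrite gt_eqF.
have px := normal_pdf_ge0 0 s x.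
have := ler_wpM2l px (expR_ge1Dx (- t)); rewrite -qE.
have : t <= (2 * l * (1 + x ^+ 4) + l ^+ 2) / (2 * s ^+ 2).
  rewrite ler_pM2r ?invr_gt0// lerD2r ler_pM2l ?mulr_gt0//.
  by have := ler_pow4 x (@ltr01 R); rewrite expr1n divr1.
by move=> /(ler_wpM2r px); lra.
Qed.

Let integral_q : ((1 - equidistribution_error)%:E <= \int[mu]_x (q x)%:E)%E.
Proof.
have s20 : 0 < 2 * s ^+ 2 by rewrite mulr_gt0// exprn_gt0.
pose A := (2 * l + l ^+ 2) / (2 * s ^+ 2); pose B := 2 * l / (2 * s ^+ 2).
have A0 : 0 <= A by rewrite divr_ge0 ?addr_ge0 ?mulr_ge0 ?sqr_ge0// ltW.
have B0 : 0 <= B by rewrite divr_ge0 ?mulr_ge0// ltW.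
have px x : 0 <= p x by exact: normal_pdf_ge0.
have x4 (x : R) : 0 <= x ^+ 4 by rewrite exprn_even_ge0.
have mAp : measurable_fun setT (fun x : R => (A%:E * (p x)%:E)%E).
  by apply/measurable_EFinP; exact: measurable_funM.
have mBp : measurable_fun setT (fun x : R => (B%:E * ((x ^+ 4)%:E * (p x)%:E))%E).
  apply/measurable_EFinP; apply: measurable_funM => //; exact: measurable_funM.
have : (1 <= \int[mu]_x (q x)%:E + (A + B * (30 * s ^+ 4))%:E)%E.
  rewrite -(integral_normal_pdf 0 s).
  apply: (@le_trans _ _ (\int[mu]_x ((q x)%:E +
      (A%:E * (p x)%:E + B%:E * ((x ^+ 4)%:E * (p x)%:E))))%E).
    apply: ge0_le_integral => //.
    - by move=> x _; rewrite lee_fin.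
    - exact/measurable_EFinP.
    - by apply: emeasurable_funD; [exact/measurable_EFinP|exact: emeasurable_funD].
    - move=> x _; rewrite -!EFinM -!EFinD lee_fin (le_trans (pdf_le_q x))// lerD2l.
      by rewrite /A /B; lra.
  rewrite ge0_integralD//; last 4 first.
  - by move=> x _; rewrite lee_fin.
  - exact/measurable_EFinP.
  - by move=> x _; rewrite -!EFinM -EFinD lee_fin; apply: addr_ge0; apply: mulr_ge0 => //; exact: mulr_ge0.
  - exact: emeasurable_funD.
  rewrite leeD2l// ge0_integralD//; last 2 first.
  - by move=> x _; rewrite -EFinM lee_fin mulr_ge0.
  - by move=> x _; rewrite -!EFinM lee_fin; apply: mulr_ge0 => //; exact: mulr_ge0.
  rewrite EFinD leeD//.
    rewrite ge0_integralZl//; last 2 first.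
    - exact/measurable_EFinP.
    - by move=> x _; rewrite lee_fin.
    by rewrite integral_normal_pdf mule1.
  rewrite ge0_integralZl//; last 2 first.
  - by apply/measurable_EFinP; apply: measurable_funM => //; exact: measurable_funX.
  - by move=> x _; rewrite -EFinM lee_fin mulr_ge0.
  by rewrite [leRHS]EFinM lee_wpmul2l ?lee_fin// integral_pow4_normal_pdf.
have -> : A + B * (30 * s ^+ 4) = equidistribution_error.
  by rewrite /A /B /equidistribution_error -/l; ring.
by rewrite EFinB leeBlDr.
Qed.

(** The function [x |-> g (fractional (k * x - a))] has period [l = 1 / k].  By
    [pdf_shift], its integral against [p] is at least its integral against each
    translate [q (x - l * v)], [v] in the unit interval, that is the integral of
    [g (fractional (k * x - a + v))] against [q].  Averaging over [v] replaces the
    function by its mean, and the mass of [q] is close to [1].  The bound is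
    uniform in [a], which is random in the application. *)
Lemma equidistribution (g : R -> R) a : measurable_fun setT g ->
  (forall v, 0 <= g v) ->
  ((1 - equidistribution_error)%:E * \int[mu]_v (on_unit g v)%:E <=
   \int[mu]_x ((g (fractional (k * x - a)))%:E * (p x)%:E))%E.
Proof.
move=> mg g0; set I := (\int[mu]_v _)%E; set C := (X in (_ <= X)%E).
have I0 : (0 <= I)%E.
  by apply: integral_ge0 => v _; rewrite lee_fin /on_unit; case: ifP.
have C0 : (0 <= C)%E.
  by apply: integral_ge0 => x _; rewrite -EFinM lee_fin mulr_ge0// normal_pdf_ge0.
pose H (x v : R) := on_unit (fun v => g (fractional (k * x - a + v))) v * q x.
have H0 x v : 0 <= H x v by rewrite mulr_ge0// /on_unit; case: ifP.
have mgf := measurableT_comp mg (@measurable_fractional R).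
have mH : measurable_fun [set: R * R] (fun z => (H z.1 z.2)%:E).
  apply/measurable_EFinP; apply: measurable_funM.
    apply: measurable_fun_ifT => //.
      by apply: measurable_and; [apply: measurable_fun_ler|apply: measurable_fun_ltr] => //;
        exact: measurable_snd.
    apply: (measurableT_comp mgf); apply: measurable_funD; last exact: measurable_snd.
    apply: measurable_funB => //; apply: measurable_funM => //; exact: measurable_fst.
  exact: (measurableT_comp mq measurable_fst).
have mgx b : measurable_fun setT (fun x : R => g (fractional (k * x + b))).
  by apply: (measurableT_comp mgf); apply: measurable_funD => //; exact: measurable_funM.
have xH x : (\int[mu]_v (H x v)%:E = I * (q x)%:E)%E.
  under eq_integral do rewrite EFinM.
  rewrite ge0_integralZr//.
  - by rewrite integral_on_unit_fractional.
  - apply/measurable_EFinP; apply: measurable_on_unit.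
    by apply: (measurableT_comp mgf); exact: measurable_funD.
  - by move=> v _; rewrite lee_fin /on_unit; case: ifP.
  - by rewrite lee_fin.
have vH v : (\int[mu]_x (H x v)%:E <= C * (on_unit (fun=> 1) v)%:E)%E.
  rewrite /H /on_unit; case: ifPn => [v01|_]; last first.
    by rewrite mule0; under eq_integral do rewrite mul0r; rewrite integral0.
  rewrite mule1 -(@ge0_integral_translation _ _ (- (l * v))); last 2 first.
  - by apply/measurable_EFinP; apply: measurable_funM => //;
      under eq_fun do rewrite -addrA; exact: mgx.
  - by move=> x; rewrite lee_fin mulr_ge0.
  apply: ge0_le_integral => //.
  - by move=> x _; rewrite lee_fin mulr_ge0.
  - apply/measurable_EFinP; apply: measurable_funM.
      under eq_fun do rewrite mulrDr -!addrA; exact: mgx.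
    by apply: (measurableT_comp mq); exact: measurable_funD.
  - by apply/measurable_EFinP; apply: measurable_funM => //; exact: mgx.
  - move=> x _; rewrite -EFinM lee_fin.
    have -> : k * (x + - (l * v)) - a + v = k * x - a.
      by rewrite /l; field; rewrite gt_eqF.
    by rewrite ler_wpM2l// pdf_shift//; move: v01; lra.
apply: (@le_trans _ _ (I * \int[mu]_x (q x)%:E)%E).
  by rewrite muleC lee_wpmul2l.
rewrite -ge0_integralZl//; last 2 first.
- exact/measurable_EFinP.
- by move=> x _; rewrite lee_fin.
under eq_integral do rewrite -xH.
rewrite (@fubini_tonelli _ _ _ _ _ mu mu (fun z => (H z.1 z.2)%:E))//; last first.
  by move=> z; rewrite lee_fin.
apply: (@le_trans _ _ (\int[mu]_v (C * (on_unit (fun=> 1) v)%:E))%E).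
  apply: ge0_le_integral => //.
  - by move=> v _; apply: integral_ge0 => x _; rewrite lee_fin.
  - by apply: (@measurable_fun_fubini_tonelli_G _ _ _ _ _ mu (fun z => (H z.1 z.2)%:E)) => // z;
      rewrite lee_fin.
  - by apply: measurable_funeM; apply/measurable_EFinP; exact: measurable_on_unit.
  - by move=> v _; exact: vH.
rewrite ge0_integralZl//.
- by rewrite integral_on_unit1 mule1.
- by apply/measurable_EFinP; exact: measurable_on_unit.
- by move=> v _; rewrite lee_fin /on_unit; case: ifP.
Qed.

End equidistribution.

(** * Reading the last lattice point off a backward grid *)

Section backward_grid.
Variables (R : realType) (x : R -> R) (eta t : R).
Hypotheses (cx : {within `[0, +oo[, continuous x}) (x0 : x 0 = 0)
  (eta_gt0 : 0 < eta) (t_gt0 : 0 < t).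

(** Beyond [n] the grid jumps to [0], so that the last increment of a Wiener path
    along the grid is its value at [t / 2], independent of the previous ones. *)
Definition backward_grid n j : R :=
  if (j <= n)%N then t - j%:R * (t / 2 / n%:R) else 0.

Definition grid_increments n i : R :=
  (x (backward_grid n i.+1) - x (backward_grid n i)) / eta.

Lemma backward_grid0 n : backward_grid n 0 = t.
Proof. by rewrite /backward_grid leq0n mul0r subr0. Qed.

Lemma backward_grid_last n : (0 < n)%N -> backward_grid n n = t / 2.
Proof.
move=> n0; rewrite /backward_grid leqnn mulrC divfK; first by lra.
by rewrite pnatr_eq0 -lt0n.
Qed.

Lemma backward_grid_itv n j : (0 < n)%N -> (j <= n)%N -> t / 2 <= backward_grid n j <= t.
Proof.
have tpos := t_gt0; move=> n0 jn; rewrite /backward_grid jn.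
have h0 : 0 < t / 2 by lra.
have jn' : (j%:R : R) <= n%:R by rewrite ler_nat.
have n0' : 0 < (n%:R : R) by rewrite ltr0n.
have a : 0 <= j%:R * (t / 2 / n%:R) by rewrite mulr_ge0// divr_ge0// ltW.
have b : j%:R * (t / 2 / n%:R) <= t / 2.
  by rewrite mulrCA ger_pMr// ler_pdivrMr// mul1r.
by lra.
Qed.

Lemma walk_pos_grid n j :
  walk_pos (grid_increments n) j = (x (backward_grid n j) - x t) / eta.
Proof.
rewrite walk_posE; elim: j => [|j IH].
  by rewrite big_geq// backward_grid0 subrr mul0r.
by rewrite big_nat_recr//= IH /grid_increments; field; rewrite gt_eqF.
Qed.

Lemma backward_grid_near n j r : (0 < n)%N -> (j <= n)%N -> backward_grid n j <= r <= t ->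
  exists2 i, (i <= j)%N & 0 <= backward_grid n i - r < t / 2 / n%:R.
Proof.
have tpos := t_gt0; move=> n0 jn; rewrite {1}/backward_grid jn => /andP[jr rt].
set h := t / 2 / n%:R in jr *.
have h0 : 0 < h by rewrite !divr_gt0// ltr0n.
pose i := Num.truncn ((t - r) / h).
have tr : 0 <= (t - r) / h by rewrite divr_ge0 ?subr_ge0// ltW.
have /andP[i1 i2] := truncn_itv tr; rewrite -/i in i1 i2.
have ij : (i <= j)%N.
  rewrite -(ler_nat R) (le_trans i1)// ler_pdivrMr//; lra.
exists i => //; rewrite /backward_grid (leq_trans ij jn) -/h.
move: i1 i2; rewrite ler_pdivlMr// ltr_pdivrMr// -natr1; lra.
Qed.

Local Notation u := (fractional (x t / eta)).
Local Notation k := (Num.floor (x t / eta)).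
Let phi := last_discr_time x eta t.

(** The walk along the grid only sees the path at the grid points.  The margin [del]
    exceeds the oscillation of the path between them for [n] large, so the path
    leaves its cell through the barrier that the walk has crossed by more than
    [del], before coming near the other one. *)
Lemma last_discr_time_grid (del : R) : 0 < del -> exists N, forall n, (N <= n)%N ->
  (u + del < walk_lo (grid_increments n) n -> x phi = k%:~R * eta) /\
  (walk_hi (grid_increments n) n < u - del -> x phi = (k + 1)%:~R * eta).
Proof.
have tpos := t_gt0; have etapos := eta_gt0.
move=> d0; have [d dpos xd] := path_unif_continuous t cx (mulr_gt0 d0 eta_gt0).
have t0 := ltW t_gt0; set U := u; set K := k.
have u01 : 0 <= U < 1 := fractional_itv (x t / eta).
have xt : x t = (K%:~R + U) * eta by rewrite /U /fractional addrC subrK divfK// gt_eqF.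
exists (Num.truncn (t / 2 / d)).+1 => n nN.
have n0 : (0 < n)%N by exact: leq_trans nN.
have hd : t / 2 / n%:R < d.
  rewrite ltr_pdivrMr ?ltr0n// [d * _]mulrC -ltr_pdivrMr//.
  by apply: (lt_le_trans (truncnS_gt _)); rewrite ler_nat.
have near j r : (j <= n)%N -> backward_grid n j <= r <= t ->
    exists2 i, (i <= j)%N & `|x (backward_grid n i) - x r| < del * eta.
  move=> jn jrt; have [i ij /andP[ir1 ir2]] := backward_grid_near n0 jn jrt.
  exists i => //; apply: xd.
  - by have := backward_grid_itv n0 (leq_trans ij jn); lra.
  - by have := backward_grid_itv n0 jn; lra.
  - by rewrite ger0_norm// (lt_trans ir2).
have [_ lohi hi1] := walk_lo_hi (grid_increments n) n.
have [lo0 _ _] := walk_lo_hi (grid_increments n) n.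
split=> [ulo|hiu].
  have [|j jn [posj posi]] := walk_lo_exit _ ulo; first by lra.
  apply: (last_discr_time_bottom cx x0 eta_gt0 t0 (q := backward_grid n j)).
  - by have := backward_grid_itv n0 jn; lra.
  - move: posj; rewrite walk_pos_grid ltr_pdivrMr//.
    have U0 : 0 <= U * eta by rewrite mulr_ge0 ?(ltW eta_gt0)//; lra.
    by have := mulr_gt0 d0 eta_gt0; rewrite xt; lra.
  - move=> r jrt; have [i ij xir] := near j r jn jrt.
    have := posi i ij; rewrite walk_pos_grid ltr_pdivrMr// xt intrD.
    by move: xir; rewrite ltr_norml; lra.
have [|j jn [posj posi]] := walk_hi_exit _ hiu; first by lra.
have ue : U * eta < eta by rewrite gtr_pMl//; lra.
apply: (last_discr_time_top cx x0 eta_gt0 t0 (q := backward_grid n j)).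
- by have := backward_grid_itv n0 jn; lra.
- move: posj; rewrite walk_pos_grid ltr_pdivlMr// xt intrD.
  by have := mulr_gt0 d0 eta_gt0; lra.
- move=> r jrt; have [i ij xir] := near j r jn jrt.
  have := posi i ij; rewrite walk_pos_grid ltr_pdivlMr// xt addrK.
  by move: xir; rewrite ltr_norml; lra.
Qed.

End backward_grid.

Section rational_description.
Variables (R : realType) (x : R -> R) (eta t : R).
Hypotheses (cx : {within `[0, +oo[, continuous x}) (x0 : x 0 = 0)
  (eta_gt0 : 0 < eta) (t_gt0 : 0 < t).
Let phi := last_discr_time x eta t.

(** A description by countably many values of the path, from which measurability
    follows.  The time [q] comes shortly before the last visit of the lattice, or is
    [0]: from [q] on, the path stays in a compact part of the two cells around
    [k eta], and it comes arbitrarily near to [k eta]. *)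
Lemma last_discr_time_rational (k : int) : x phi = k%:~R * eta <->
  exists q : rat, 0 <= (ratr q : R) < t /\
    (exists m : nat, forall r : rat, (ratr q : R) <= ratr r <= t ->
      `|x (ratr r) - k%:~R * eta| <= eta - m.+1%:R^-1) /\
    (forall p : nat, exists r : rat, (ratr q : R) <= ratr r <= t /\
      `|x (ratr r) - k%:~R * eta| < p.+1%:R^-1).
Proof.
have tpos := t_gt0; have etapos := eta_gt0.
have t0 := ltW t_gt0; set c := k%:~R * eta.
have inv_lt (e : R) : 0 < e -> exists m : nat, m.+1%:R^-1 < e.
  by move=> e0; have /ltr_add_invr[m] := e0; rewrite add0r => H; exists m.
have dense (a b : R) : a < b -> exists r : rat, a < ratr r < b.
  by move=> /rat_in_itvoo[r]; rewrite in_itv/= => H; exists r.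
have cy : {within `[0, +oo[, continuous (fun r => `|x r - c|)}.
  by move=> r; apply: cvg_norm; apply: cvgB; [exact: cx|exact: cvg_cst].
have cy' a b : 0 <= a -> {within `[a, b], continuous (fun r => `|x r - c|)}.
  move=> a0; apply: continuous_subspaceW cy => r /=; rewrite !in_itv/= => /andP[ar _].
  by rewrite (le_trans a0).
split=> [xphi|[q [/andP[q0 qt] [[m qm] qp]]]].
  have [/andP[s0 st] _ near_s] := last_discr_time_spec cx x0 eta_gt0 t0.
  rewrite -/phi in s0 st near_s; rewrite xphi -/c in near_s.
  have [b] := EVT_max st (cy' phi t s0).
  rewrite in_itv/= => bst bmax; have := near_s b bst.
  set M := `|x b - c| => Me.
  have M0 : 0 <= M by exact: normr_ge0.
  pose e := (eta - M) / 2; have e0 : 0 < e by rewrite /e; lra.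
  have [d d0 xd] := path_unif_continuous t cx e0.
  have [m me] := inv_lt e e0.
  suff [q [q0t qs sqd qapprox]] : exists q : rat, [/\ 0 <= (ratr q : R) < t,
      ratr q <= phi, phi - ratr q < d & forall e, 0 < e -> exists r : rat,
      (ratr q : R) <= ratr r <= t /\ `|x (ratr r) - c| < e].
    exists q; split => //; split; last by move=> p; exact: qapprox.
    exists m => r /andP[qr rt]; move: me; set im := m.+1%:R^-1 => me.
    have [sr|rs] := leP phi (ratr r).
      have := bmax (ratr r); rewrite in_itv/= sr rt => /(_ isT).
      by rewrite -/M /e in me *; lra.
    have := xd (ratr r) phi; rewrite xphi -/c s0 st rt andbT.
    have -> : 0 <= ratr r :> R by rewrite (le_trans _ qr)//; case/andP: q0t.
    rewrite ltr0_norm ?subr_lt0//; have -> : - (ratr r - phi) < d by lra.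
    by move=> /(_ isT isT isT); rewrite /e in me *; lra.
  have [sz|sn0] := eqVneq phi 0.
    exists 0; rewrite !rmorph0 lexx t_gt0 sz subr0; split => // e' e'0.
    exists 0; rewrite !rmorph0 lexx t0; split => //.
    by rewrite -{1}sz xphi subrr normr0.
  have s_gt0 : 0 < phi by rewrite lt_neqAle eq_sym sn0.
  (* Just before the last visit, so that the path has not moved much since [q]. *)
  have [q /andP[q1 q2]] : exists q : rat, Num.max 0 (phi - d) < ratr q < phi.
    by apply: dense; rewrite gt_max s_gt0/=; lra.
  move: q1; rewrite gt_max => /andP[q0 qd].
  exists q; split; [by lra|by lra|by lra|].
  move=> e' e'0; have [d' d'0 xd'] := path_unif_continuous t cx e'0.
  have [r /andP[r1 r2]] : exists r : rat, Num.max (ratr q) (phi - d') < ratr r < phi.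
    by apply: dense; rewrite gt_max q2/=; lra.
  move: r1; rewrite gt_max => /andP[qr rd].
  exists r; split; first by lra.
  by rewrite -xphi xd'; [|lra|lra|rewrite ltr0_norm; lra].
have B_eta : eta - m.+1%:R^-1 < eta by rewrite ltrBlDr ltrDl invr_gt0.
move: B_eta qm; set B := eta - m.+1%:R^-1 => B_eta qm.
have sup_le r : ratr q <= r <= t -> `|x r - c| <= B.
  move=> /andP[qr rt]; rewrite leNgt; apply/negP => H.
  have e0 : 0 < `|x r - c| - B by rewrite subr_gt0.
  have [d d0 xd] := path_unif_continuous t cx e0.
  have [r' [r'qt rr']] : exists r' : rat, (ratr q : R) <= ratr r' <= t /\ `|r - ratr r'| < d.
    move: rt; rewrite le_eqVlt => /predU1P[->|rt].
      have [r' /andP[]] : exists r' : rat, Num.max (ratr q) (t - d) < ratr r' < t.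
        by apply: dense; rewrite gt_max qt/=; lra.
      rewrite gt_max => /andP[? ?] ?; exists r'; split; first by lra.
      by rewrite ger0_norm; lra.
    have [r' /andP[r1]] : exists r' : rat, r < ratr r' < Num.min t (r + d).
      by apply: dense; rewrite lt_min rt/=; lra.
    rewrite lt_min => /andP[? ?]; exists r'; split; first by lra.
    by rewrite ler0_norm; lra.
  have := xd r (ratr r'); rewrite rr' rt (le_trans q0 qr).
  have -> : 0 <= (ratr r' : R) <= t by lra.
  move=> /(_ isT isT isT).
  have := qm r' r'qt.
  have := ler_distD (x (ratr r')) (x r) c; lra.
have [s] := EVT_min (ltW qt) (cy' _ t q0); rewrite in_itv/= => /andP[qs st] smin.
(* The infimum of the distance to [c] on [q, t] is [0] and is attained at [s]. *)
have xs : x s = c.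
  apply/eqP; rewrite -subr_eq0 -normr_le0 leNgt; apply/negP => /inv_lt[p ps].
  have [r [qrt rp]] := qp p.
  have := smin (ratr r); rewrite in_itv/= qrt => /(_ isT).
  by move=> /le_lt_trans/(_ rp); rewrite ltNge (ltW ps).
apply: (last_discr_time_unique cx x0 eta_gt0 t0 (s := s)) => //.
  by rewrite st (le_trans q0).
move=> r /andP[sr rt]; rewrite -/c (le_lt_trans (sup_le r _))//.
  by rewrite rt (le_trans qs).
Qed.

End rational_description.

Section measurability.
Context d (T : measurableType d) (R : realType).
Variables (X : R -> T -> R) (eta t : R).
Hypotheses (mX : forall s, 0 <= s -> measurable_fun setT (X s))
  (cX : forall w, {within `[0, +oo[, continuous (fun s => X s w)})
  (X0 : forall w, X 0 w = 0) (eta_gt0 : 0 < eta) (t_gt0 : 0 < t).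

Let phi w := last_discr_time (fun s => X s w) eta t.

Let measurable_lattice (k : int) : measurable [set w | X (phi w) w = k%:~R * eta].
Proof.
pose c := k%:~R * eta.
have mXc (r q : rat) : 0 <= (ratr q : R) < t -> (ratr q : R) <= ratr r <= t ->
    measurable_fun setT (fun w => `|X (ratr r) w - c|).
  move=> /andP[q0 _] /andP[qr _]; apply: measurableT_comp => //.
  by apply: measurable_funB => //; apply: mX; exact: le_trans qr.
rewrite (_ : [set w | _] =
  \bigcup_(q in [set q : rat | 0 <= (ratr q : R) < t])
   ((\bigcup_m \bigcap_(r in [set r : rat | (ratr q : R) <= ratr r <= t])
      [set w | `|X (ratr r) w - c| <= eta - m.+1%:R^-1]) `&`
    (\bigcap_p \bigcup_(r in [set r : rat | (ratr q : R) <= ratr r <= t])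
      [set w | `|X (ratr r) w - c| < p.+1%:R^-1]))).
  rewrite bigcup_mkcond; apply: bigcupT_measurable_rat => q; case: ifPn => //.
  rewrite inE/= => qt; apply: measurableI.
    apply: bigcupT_measurable => m.
    rewrite bigcap_mkcond -[X in measurable X]setCK; apply: measurableC.
    rewrite setC_bigcap; apply: bigcupT_measurable_rat => r; apply: measurableC.
    case: ifPn => //; rewrite inE/= => qr; apply: measurable_event.
    by apply: measurable_fun_ler => //; exact: mXc qr.
  apply: bigcapT_measurable => p; rewrite bigcup_mkcond.
  apply: bigcupT_measurable_rat => r; case: ifPn => //; rewrite inE/= => qr.
  apply: measurable_event.
  by apply: measurable_fun_ltr => //; exact: mXc qr.
apply/seteqP; split=> w /=.
  move/(last_discr_time_rational (@cX w) (X0 w) eta_gt0 t_gt0) => [q [qt [[m qm] qp]]].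
  by exists q => //; split; [exists m|move=> p _; have [r [qr rp]] := qp p; exists r].
move=> [q qt [[m _ qm] qp]].
apply/(last_discr_time_rational (@cX w) (X0 w) eta_gt0 t_gt0); exists q; split => //.
split; first by exists m.
by move=> p; have [r qr rp] := qp p I; exists r.
Qed.

Lemma measurable_last_lattice_point : measurable_fun setT (fun w => X (phi w) w).
Proof.
move=> _ B mB; rewrite setTI.
rewrite (_ : _ @^-1` B = \bigcup_(k in [set k : int | B (k%:~R * eta)])
  [set w | X (phi w) w = k%:~R * eta]).
  rewrite bigcup_mkcond; apply: countable_bigcupT_measurable; first exact: countableP.
  move=> k.
  by case: ifPn => // _; exact: measurable_lattice.
apply/seteqP; split=> [w /= Bw|w [k /= Bk Xk]]; last by rewrite /= Xk.
have [_ [k Xk] _] := last_discr_time_spec (@cX w) (X0 w) eta_gt0 (ltW t_gt0).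
by exists k => //=; rewrite -Xk.
Qed.

End measurability.

(** * Increments of the Wiener process along the backward grid *)

Section wiener_grid.
Context d (T : measurableType d) (R : realType).
Variables (P : probability T R) (W : R -> T -> R) (t : R).
Hypotheses (W_wiener : wiener_process P W) (t_gt0 : 0 < t).

Lemma backward_grid_ge0 n j : 0 <= backward_grid t n j.
Proof.
case: (posnP n) => [->|n0]; rewrite /backward_grid.
  by case: ifP => // _; rewrite invr0 mulr0 mulr0 subr0 ltW.
have [jn|//] := leqP j n.
have := backward_grid_itv t_gt0 n0 jn; rewrite /backward_grid jn.
by have := t_gt0; lra.
Qed.

Lemma backward_grid_nonincreasing n i j : (0 < n)%N -> (i <= j)%N ->
  backward_grid t n j <= backward_grid t n i.
Proof.
move=> n0 ij; have [jn|nj] := leqP j n; last first.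
  by rewrite {1}/backward_grid leqNgt nj/=; exact: backward_grid_ge0.
rewrite /backward_grid jn (leq_trans ij jn) lerB// ler_wpM2r ?ler_nat//.
by rewrite !divr_ge0// ltW.
Qed.

Let delta n j w := W (backward_grid t n j) w - W (backward_grid t n j.+1) w.

Lemma measurable_wiener_increment n j : measurable_fun setT (delta n j).
Proof.
by apply: measurable_funB; apply: (wiener_measurable W_wiener);
  exact: backward_grid_ge0.
Qed.

(** The grid is read backwards and the increments of the process forwards, hence the
    reversal of the indices. *)
Lemma wiener_increments_independent n : (0 < n)%N ->
  independent_sequence P n.+1 (delta n).
Proof.
move=> n0 B mB; pose s i := backward_grid t n (n.+1 - i)%N.
have s0 : 0 <= s 0%N by exact: backward_grid_ge0.
have s_nd : nondecreasing_seq s.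
  by move=> i j ij; apply: backward_grid_nonincreasing => //; exact: leq_sub2l.
have := wiener_independent_increments W_wiener (n := n.+1) s0 s_nd.
move=> /(_ (finset.setTfor 'I_n.+1) (fun i => B (n - i)%N) (fun i => mB _)).
have E (i : 'I_n.+1) : (fun w => W (s i.+1) w - W (s i) w) = delta n (n - i)%N.
  by apply/funext => w; rewrite /s /delta subSS subSn// -ltnS.
rewrite (_ : \bigcap_(i in _) _ = \bigcap_(i in `I_n.+1) (delta n i @^-1` B i)).
  move=> ->; rewrite big_mkord [RHS](reindex_inj rev_ord_inj)/=.
  by apply: eq_big => i; rewrite ?inE// => _; rewrite E subSS.
apply/seteqP; split=> w H.
  move=> i iN; pose i' := rev_ord (Ordinal (iN : (i < n.+1)%N)).
  have i'E : (n - i' = i)%N by rewrite /= subSS subKn.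
  by rewrite -i'E -E; apply: H; rewrite /= inE.
move=> i _; rewrite E; apply: H => /=.
by rewrite ltnS leq_subr.
Qed.

Lemma wiener_increment_law n j (A : set R) : (0 < n)%N -> (j < n)%N -> measurable A ->
  P (delta n j @^-1` A) = normal_prob 0 (Num.sqrt (t / 2 / n%:R)) A.
Proof.
move=> n0 jn mA.
have h0 : 0 < t / 2 / n%:R by rewrite !divr_gt0// ltr0n.
have E : backward_grid t n j - backward_grid t n j.+1 = t / 2 / n%:R.
  by rewrite /backward_grid jn (ltnW jn) -natr1; ring.
rewrite (wiener_normal_increments W_wiener) ?E//; first exact: backward_grid_ge0.
by rewrite -subr_gt0 E.
Qed.

Lemma wiener_last_increment_law n (A : set R) : (0 < n)%N -> measurable A ->
  P (delta n n @^-1` A) = normal_prob 0 (Num.sqrt (t / 2)) A.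
Proof.
move=> n0 mA.
have E : backward_grid t n n.+1 = 0 by rewrite /backward_grid ltnn.
rewrite /delta backward_grid_last// E (wiener_normal_increments W_wiener) ?subr0//.
by rewrite divr_gt0.
Qed.

End wiener_grid.

Section scaled_normal.
Context d (T : measurableType d) (R : realType).
Variables (P : probability T R) (D : T -> R) (s k : R).
Hypotheses (mD : measurable_fun setT D) (s0 : 0 < s)
  (DN : forall A : set R, measurable A -> P (D @^-1` A) = normal_prob 0 s A).

Lemma integral_normal_law (f : R -> \bar R) : measurable_fun setT f ->
  (forall x, (0 <= f x)%E) ->
  (\int[P]_w f (D w) = \int[lebesgue_measure]_x (f x * (normal_pdf 0 s x)%:E))%E.
Proof.
apply: integral_law_density => //; first exact: measurable_normal_pdf.
by move=> x; exact: normal_pdf_ge0.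
Qed.

Lemma scaled_normal_symmetric :
  (\int[P]_w (Num.max (- (k * D w)) 0)%:E = \int[P]_w (Num.max (- - (k * D w)) 0)%:E)%E.
Proof.
have mk : measurable_fun setT (fun x : R => k * x) by exact: measurable_funM.
have m1 : measurable_fun setT (fun x : R => (Num.max (- (k * x)) 0)%:E).
  by apply/measurable_EFinP; apply: measurable_maxr => //; exact: measurable_funN.
have m2 : measurable_fun setT (fun x : R => (Num.max (- - (k * x)) 0)%:E).
  by apply/measurable_EFinP; apply: measurable_maxr => //; do 2 apply: measurable_funN.
have max0 (y : R) : 0 <= Num.max y 0 by rewrite le_max lexx orbT.
rewrite (integral_normal_law m1); last by move=> x; rewrite lee_fin.
rewrite (integral_normal_law m2); last by move=> x; rewrite lee_fin.
rewrite -ge0_integral_reflection.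
- by apply: eq_integral => x _; rewrite normal_pdf0N// mulrN.
- by apply: emeasurable_funM => //; apply/measurable_EFinP; exact: measurable_normal_pdf.
- by move=> x; rewrite mule_ge0 ?lee_fin// normal_pdf_ge0.
Qed.

Lemma scaled_normal_pow4 :
  (\int[P]_w ((- (k * D w)) ^+ 4)%:E <= (30 * (k ^+ 4 * s ^+ 4))%:E)%E.
Proof.
have m1 : measurable_fun setT (fun x : R => ((- (k * x)) ^+ 4)%:E).
  by apply/measurable_EFinP; apply: measurable_funX; apply: measurable_funN; exact: measurable_funM.
rewrite (integral_normal_law m1); last by move=> x; rewrite lee_fin exprn_even_ge0.
have k4 : 0 <= k ^+ 4 by rewrite exprn_even_ge0.
under eq_integral do rewrite -mulN1r exprMn -signr_odd expr0 mul1r exprMn EFinM -muleA.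
rewrite ge0_integralZl//.
- by rewrite mulrCA [leRHS]EFinM lee_wpmul2l// integral_pow4_normal_pdf.
- apply: emeasurable_funM; apply/measurable_EFinP; last exact: measurable_normal_pdf.
  exact: measurable_funX.
- by move=> x _; rewrite -EFinM lee_fin mulr_ge0 ?normal_pdf_ge0// exprn_even_ge0.
Qed.

(** A normal variable of large variance is rarely in (-1, 1). *)
Lemma scaled_normal_small : 0 < k ->
  (P [set w | (`|- (k * D w)| < 1)%R] <= (2 * k^-1 * normal_peak s)%:E)%E.
Proof.
move=> k0; rewrite (_ : [set w | _] = D @^-1` `](- k^-1)%R, k^-1[).
  by rewrite DN//; apply: integral_normal_pdf_small => //; rewrite invr_ge0 ltW.
apply/seteqP; split=> w /=; rewrite in_itv/= -ltr_norml normrN normrM gtr0_norm//.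
  by rewrite mulrC -ltr_pdivlMr// div1r.
by rewrite -[X in _ < X -> _]div1r ltr_pdivlMr// mulrC.
Qed.

End scaled_normal.

(** * Lower bound for the expectation of a nonnegative test function *)

Section one_sided_bound.
Context d (T : measurableType d) (R : realType).
Variables (P : probability T R) (W : R -> T -> R) (sigma t eta : R).
Hypotheses (W_wiener : wiener_process P W) (sigma_gt0 : 0 < sigma) (t_gt0 : 0 < t)
  (eta_gt0 : 0 < eta).

Let X s w := sigma * W s w.
Let k := sigma / eta.
Let k_gt0 : 0 < k. Proof. exact: divr_gt0. Qed.
Let s := Num.sqrt (t / 2).
Let s_gt0 : 0 < s. Proof. by rewrite sqrtr_gt0 divr_gt0. Qed.
Let Z n j w := grid_increments (fun r => X r w) eta t n j.
Let delta n j w := W (backward_grid t n j) w - W (backward_grid t n j.+1) w.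
Let lo n w := walk_lo (fun j => Z n j w) n.
Let hi n w := walk_hi (fun j => Z n j w) n.
Let pos n w := walk_pos (fun j => Z n j w) n.
Let Xphi w := X (last_discr_time (fun r => X r w) eta t) w.
Let u w := fractional (X t w / eta).
Let Y w := eta^-1 * (X t w - Xphi w).

Let ZE n j w : Z n j w = - (k * delta n j w).
Proof. by rewrite /Z /grid_increments /X /delta /k; field; rewrite gt_eqF. Qed.

Let mX r : 0 <= r -> measurable_fun setT (X r).
Proof. by move=> r0; apply: measurable_funM => //; exact: (wiener_measurable W_wiener). Qed.

Let cX w : {within `[0, +oo[, continuous (fun r => X r w)}.
Proof. by move=> r; apply: cvgMr; exact: (wiener_continuous W_wiener). Qed.

Let X0 w : X 0 w = 0.
Proof. by rewrite /X (wiener_start W_wiener) mulr0. Qed.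

Let mdelta n j : measurable_fun setT (delta n j).
Proof. exact: (measurable_wiener_increment W_wiener). Qed.

Let mZ n j : measurable_fun setT (Z n j).
Proof.
rewrite (_ : Z n j = fun w => - (k * delta n j w)); last by apply/funext => w; exact: ZE.
by apply: measurable_funN; exact: measurable_funM.
Qed.

Let indZ n : (0 < n)%N -> independent_sequence P n.+1 (Z n).
Proof.
move=> n0; rewrite (_ : Z n = fun j w => - (k * delta n j w)); last first.
  by apply/funext => j; apply/funext => w; exact: ZE.
apply: (independent_sequence_comp (h := fun x => - (k * x))).
  by apply: measurable_funN; exact: measurable_funM.
exact: wiener_increments_independent.
Qed.

Let step n := Num.sqrt (t / 2 / n%:R).

Let step_gt0 n : (0 < n)%N -> 0 < step n.
Proof. by move=> n0; rewrite sqrtr_gt0 !divr_gt0// ltr0n. Qed.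

Let M n := 30 * (k ^+ 4 * step n ^+ 4).

Let symZ n j : (j < n)%N -> (\int[P]_w (Num.max (Z n j w) 0)%:E =
  \int[P]_w (Num.max (- Z n j w) 0)%:E)%E.
Proof.
move=> jn; have n0 : (0 < n)%N by exact: leq_trans jn.
under eq_integral do rewrite ZE; under [RHS]eq_integral do rewrite ZE.
apply: (scaled_normal_symmetric k (mdelta n j) (step_gt0 n0)) => A mA.
exact: (wiener_increment_law W_wiener).
Qed.

Let m4Z n j : (j < n)%N -> (\int[P]_w (Z n j w ^+ 4)%:E <= (M n)%:E)%E.
Proof.
move=> jn; have n0 : (0 < n)%N by exact: leq_trans jn.
under eq_integral do rewrite ZE.
apply: (scaled_normal_pow4 k (mdelta n j) (step_gt0 n0)) => A mA.
exact: (wiener_increment_law W_wiener).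
Qed.

(** A bound on the probability that [X] moves by less than [eta] between [t / 2] and
    [t]; when it moves more, the backward path has left its cell. *)
Definition unexited_bound := 2 * (sigma / eta)^-1 * normal_peak (Num.sqrt (t / 2)).

Let posE n w : (0 < n)%N -> pos n w = - (k * (W t w - W (t / 2) w)).
Proof.
move=> n0; rewrite /pos walk_pos_grid// backward_grid_last//.
by rewrite /X /k; field; rewrite gt_eqF.
Qed.

Let pos_small n : (0 < n)%N ->
  (P [set w | (`|pos n w| < 1)%R] <= unexited_bound%:E)%E.
Proof.
move=> n0; under eq_set do rewrite posE//.
have t20 : 0 <= t / 2 by rewrite divr_ge0// ltW.
have tt : t - t / 2 = t / 2 by lra.
apply: (@scaled_normal_small _ _ _ P (fun w => W t w - W (t / 2) w) s k) => //.
move=> A mA; rewrite (wiener_normal_increments W_wiener) ?tt//.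
by have := t_gt0; lra.
Qed.

Let err n e := unexited_bound + (e + n%:R * M n / e ^+ 3).

Let mlo n : measurable_fun setT (lo n). Proof. exact: measurable_walk_lo. Qed.
Let mhi n : measurable_fun setT (hi n). Proof. exact: measurable_walk_hi. Qed.

Let err_ge0 n e : 0 < e -> 0 <= err n e.
Proof.
move=> e0; rewrite /err /unexited_bound /M !addr_ge0//.
- by rewrite !mulr_ge0 ?normal_peak_ge0// invr_ge0 ltW.
- exact: ltW.
- apply: divr_ge0; last by rewrite exprn_ge0// ltW.
  by do 3 apply: mulr_ge0 => //; rewrite exprn_even_ge0.
Qed.

Let lo_probability n del e v : (0 < n)%N -> 0 < del -> 0 < e -> 0 <= v < 1 ->
  1 - v <= fine (P [set w | v + del < lo n w]) + (2 * del + err n e).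
Proof.
move=> n0 del0 e0 v01.
have mA : measurable [set w | v + del < lo n w].
  by apply: measurable_event; exact: measurable_fun_ltr.
have p0 : 0 <= fine (P [set w | v + del < lo n w]) by rewrite fine_ge0.
have E0 := err_ge0 n e0.
have [v1|v1] := leP 1 (v + 2 * del); first by lra.
have v01' : 0 < v + 2 * del < 1 by lra.
have := walk_lo_probability (mZ n) (independent_sequence_take (indZ n0)) (@symZ n) (@m4Z n) e0 v01'.
have mB : measurable [set w | v + 2 * del <= lo n w].
  by apply: measurable_event; exact: measurable_fun_ler.
have BA : (P [set w | (v + 2 * del <= lo n w)%R] <= P [set w | (v + del < lo n w)%R])%E.
  by apply: le_measure; rewrite ?inE// => w /=; lra.
move=> /le_trans H; have {H} := H _ (leeD2r _ (leeD BA (pos_small n0))).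
rewrite -(fineK (fin_num_measure P _ mA)) -!EFinD lee_fin /err; lra.
Qed.

Let hi_probability n del e v : (0 < n)%N -> 0 < del -> 0 < e -> 0 <= v < 1 ->
  v <= fine (P [set w | hi n w < v - del]) + (2 * del + err n e).
Proof.
move=> n0 del0 e0 v01.
have mA : measurable [set w | hi n w < v - del].
  by apply: measurable_event; exact: measurable_fun_ltr.
have p0 : 0 <= fine (P [set w | hi n w < v - del]) by rewrite fine_ge0.
have E0 := err_ge0 n e0.
have [v1|v1] := leP (v - 2 * del) 0; first by lra.
have v01' : 0 < v - 2 * del < 1 by lra.
have := walk_hi_probability (mZ n) (independent_sequence_take (indZ n0)) (@symZ n) (@m4Z n) e0 v01'.
have mB : measurable [set w | hi n w <= v - 2 * del].
  by apply: measurable_event; exact: measurable_fun_ler.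
have BA : (P [set w | (hi n w <= v - 2 * del)%R] <= P [set w | (hi n w < v - del)%R])%E.
  by apply: le_measure; rewrite ?inE// => w /=; lra.
move=> /le_trans H; have {H} := H _ (leeD2r _ (leeD BA (pos_small n0))).
rewrite -(fineK (fin_num_measure P _ mA)) -!EFinD lee_fin /err; lra.
Qed.

Let mXphi : measurable_fun setT Xphi.
Proof. exact: measurable_last_lattice_point. Qed.

Lemma measurable_scaled_remainder : measurable_fun setT Y.
Proof.
apply: measurable_funM => //; apply: measurable_funB => //.
by apply: mX; exact: ltW.
Qed.

Let measurable_u : measurable_fun setT u.
Proof.
apply: (measurableT_comp (@measurable_fractional R)).
by apply: measurable_funM => //; apply: mX; exact: ltW.
Qed.

Let floor_point w := (X t w / eta - u w) * eta.

Let mfloor_point : measurable_fun setT floor_point.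
Proof.
apply: measurable_funM => //; apply: measurable_funB => //.
by apply: measurable_funM => //; apply: mX; exact: ltW.
Qed.

(** The grid announces an exit that does not agree with the last lattice point;
    [floor_point] is the lattice point just below [X t]. *)
Let missed n del w :=
  ((u w + del < lo n w) && (Xphi w != floor_point w)) ||
  ((hi n w < u w - del) && (Xphi w != floor_point w + eta)).

Let measurable_missed n del : measurable_fun setT (missed n del).
Proof.
apply: measurable_or; apply: measurable_and.
- by apply: measurable_fun_ltr => //; exact: measurable_funD.
- by apply: measurable_neg; exact: measurable_fun_eqr.
- by apply: measurable_fun_ltr => //; exact: measurable_funB.
- by apply: measurable_neg; apply: measurable_fun_eqr => //; exact: measurable_funD.
Qed.

Let missed_eventually del w : 0 < del -> exists N, forall n, (N <= n)%N -> ~~ missed n del w.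
Proof.
move=> del0; have [N HN] := last_discr_time_grid (@cX w) (X0 w) eta_gt0 t_gt0 del0.
have fE : floor_point w = (Num.floor (X t w / eta))%:~R * eta.
  by rewrite /floor_point /u /fractional subKr.
exists N => n /HN[Hlo Hhi]; rewrite negb_or !negb_and !negbK.
apply/andP; split.
  by rewrite -implybE; apply/implyP => /Hlo H; apply/eqP; rewrite fE; exact: H.
rewrite -implybE; apply/implyP => /Hhi H; apply/eqP; rewrite fE /Xphi H.
by rewrite intrD mulrDl mul1r.
Qed.

(** Every path is eventually not missed, so the decreasing tail unions have empty
    intersection. *)
Let missed_cvg0 del : 0 < del -> P [set w | missed n del w] @[n --> \oo] --> 0%E.
Proof.
move=> del0.
pose F n := \bigcup_(m in [set m | (n <= m)%N]) [set w | missed m del w].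
have mF n : measurable (F n).
  by apply: bigcup_measurable => m _; exact: measurable_event.
have F0 : \bigcap_n F n = set0.
  apply/seteqP; split=> // w Fw; have [N HN] := missed_eventually w del0.
  by have [m Nm /= mw] := Fw N I; have := HN m Nm; rewrite mw.
have FP : P (F n) @[n --> \oo] --> 0%E.
  rewrite -(measure0 P) -F0; apply: nonincreasing_cvg_mu => //.
  - by rewrite (le_lt_trans (probability_le1 _ _))// ltry.
  - by rewrite F0.
  - move=> a b ab; apply/subsetPset => w [m /= bm mw].
    by exists m => //=; exact: leq_trans bm.
apply: (squeeze_cvge _ (cvg_cst 0%E) FP); apply: nearW => n.
rewrite measure_ge0/=; apply: le_measure; rewrite ?inE//; first exact: measurable_event.
by move=> w mw; exists n => //=.
Qed.

Section test_function.
Variables (f : R -> R) (C : R).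
Hypotheses (mf : measurable_fun setT f) (f0 : forall x, 0 <= f x) (fC : forall x, f x <= C).

Let C0 : 0 <= C. Proof. exact: le_trans (f0 0) (fC 0). Qed.

(** The value of [f] at the remainder announced by the grid, with margin [del], for
    a path started at [v]; it is [0] when nothing is announced, which is harmless in
    a lower bound. *)
Let Phi del v a b := (if v + del < a then f v else 0) + (if b < v - del then f (v - 1) else 0).

Let Phi_ge0 del v a b : 0 <= Phi del v a b.
Proof. by rewrite addr_ge0//; case: ifP. Qed.

Let Phi_le_remainder n del w : 0 < del ->
  Phi del (u w) (lo n w) (hi n w) <= f (Y w) + 2 * C * (if missed n del w then 1 else 0).
Proof.
move=> del0; have CC := C0; have fY := f0 (Y w).
have b1 : (if u w + del < lo n w then f (u w) else 0) <= C by case: ifP.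
have b2 : (if hi n w < u w - del then f (u w - 1) else 0) <= C by case: ifP.
have [ms|nms] := boolP (missed n del w); first by rewrite /Phi mulr1 (le_trans (lerD b1 b2))//; lra.
have [_ lohi _] := walk_lo_hi (fun j => Z n j w) n.
rewrite -/(lo n w) -/(hi n w) in lohi.
have YE c : Xphi w = c -> Y w = (X t w - c) / eta by rewrite /Y mulrC => ->.
move: nms; rewrite mulr0 addr0 /missed negb_or !negb_and !negbK /Phi => /andP[].
have [ulo /= /eqP Xw _|nulo _] := ltP (u w + del) (lo n w).
  rewrite ifF; last by apply/negbTE/negP; lra.
  rewrite addr0 (YE _ Xw) /floor_point.
  rewrite (_ : (X t w - (X t w / eta - u w) * eta) / eta = u w)//.
  by field; rewrite gt_eqF.
have [hiu /= /eqP Xw|_ _] := ltP (hi n w) (u w - del); last by rewrite addr0.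
rewrite add0r (YE _ Xw) /floor_point.
rewrite (_ : (X t w - ((X t w / eta - u w) * eta + eta)) / eta = u w - 1)//.
by field; rewrite gt_eqF.
Qed.

Let mPhi dA (A : measurableType dA) del (v a b : A -> R) :
  measurable_fun setT v -> measurable_fun setT a -> measurable_fun setT b ->
  measurable_fun setT (fun x => Phi del (v x) (a x) (b x)).
Proof.
move=> mv ma mb; apply: measurable_funD; apply: measurable_fun_ifT => //.
- by apply: measurable_fun_ltr => //; exact: measurable_funD.
- exact: measurableT_comp.
- by apply: measurable_fun_ltr => //; exact: measurable_funB.
- by apply: (measurableT_comp mf); exact: measurable_funB.
Qed.

Let integral_remainder_ge n del : (0 < n)%N -> 0 < del ->
  (\int[P]_w (Phi del (u w) (lo n w) (hi n w))%:E <=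
   \int[P]_w (f (Y w))%:E + (2 * C)%:E * P [set w | missed n del w])%E.
Proof.
move=> n0 del0.
have C2 : 0 <= 2 * C by rewrite mulr_ge0.
have mi : measurable_fun setT (fun w => (if missed n del w then 1 else 0) : R).
  exact: measurable_fun_ifT.
have mfY : measurable_fun setT (f \o Y).
  exact: measurableT_comp mf measurable_scaled_remainder.
rewrite -integral_indicator// -ge0_integralZl//; last 2 first.
- exact/measurable_EFinP.
- by move=> w _; rewrite lee_fin; case: ifP.
rewrite -ge0_integralD//; last 4 first.
- by move=> w _; rewrite lee_fin.
- exact/measurable_EFinP.
- by move=> w _; rewrite -EFinM lee_fin mulr_ge0//; case: ifP.
- by apply/measurable_EFinP; exact: measurable_funM.
apply: ge0_le_integral => //.
- by move=> w _; rewrite lee_fin.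
- by apply/measurable_EFinP; exact: mPhi.
- apply: emeasurable_funD; apply/measurable_EFinP => //.
  exact: measurable_funM.
- by move=> w _; rewrite -EFinM -EFinD lee_fin; exact: Phi_le_remainder.
Qed.

Let averaged n del : \bar R :=
  (\int[P]_w \int[lebesgue_measure]_v
     (on_unit (fun v => Phi del v (lo n w) (hi n w)) v)%:E)%E.

Local Notation theta := (equidistribution_error s k).

(** The state of the walk after [n] steps is independent of the last increment,
    and [u] is, up to signs, the fractional part of the sum of the displacement of
    the walk and of this normal variable: [equidistribution] applies for a fixed state. *)
Let averaged_le n del : (0 < n)%N -> 0 < del -> theta <= 1 ->
  ((1 - theta)%:E * averaged n del <= \int[P]_w (Phi del (u w) (lo n w) (hi n w))%:E)%E.
Proof.
move=> n0 del0 theta1.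
pose g (x : (R * (R * R)) * R) :=
  (Phi del (fractional (- x.2 - x.1.1)) x.1.2.1 x.1.2.2)%:E.
have m1 : measurable_fun [set: (R * (R * R)) * R] (fun x => x.1.1).
  exact: (measurableT_comp measurable_fst measurable_fst).
have m2 : measurable_fun [set: (R * (R * R)) * R] (fun x => x.1.2.1).
  apply: (measurableT_comp measurable_fst).
  exact: (measurableT_comp measurable_snd measurable_fst).
have m3 : measurable_fun [set: (R * (R * R)) * R] (fun x => x.1.2.2).
  apply: (measurableT_comp measurable_snd).
  exact: (measurableT_comp measurable_snd measurable_fst).
have mg : measurable_fun setT g.
  apply/measurable_EFinP; apply: mPhi => //.
  apply: (measurableT_comp (@measurable_fractional R)); apply: measurable_funB => //.
  by apply: measurable_funN; exact: measurable_snd.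
have g0 x : (0 <= g x)%E by rewrite lee_fin.
have mst := measurable_walk_state (mZ n) n.
have -> : (\int[P]_w (Phi del (u w) (lo n w) (hi n w))%:E =
    \int[P]_w g (walk_state (fun j => Z n j w) n, Z n n w))%E.
  apply: eq_integral => w _; rewrite /g /=; congr (Phi _ _ _ _)%:E.
  rewrite -/(walk_pos (fun j => Z n j w) n) -/(pos n w) posE// ZE.
  congr fractional; rewrite /delta backward_grid_last//.
  have -> : backward_grid t n n.+1 = 0 by rewrite /backward_grid ltnn.
  by rewrite (wiener_start W_wiener) /X /k; field; rewrite gt_eqF.
rewrite (independent_pair_integral mst (mZ n n))//; last first.
  by move=> D B; apply: (walk_state_independent (mZ n) (indZ n0)).
have mF : measurable_fun setT (fun w => \int[lebesgue_measure]_v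
     (on_unit (fun v => Phi del v (lo n w) (hi n w)) v)%:E)%E.
  pose G (z : T * measurableTypeR R) :=
    (on_unit (fun v => Phi del v (lo n z.1) (hi n z.1)) z.2)%:E.
  apply: (@measurable_fun_fubini_tonelli_F _ _ T (measurableTypeR R) R lebesgue_measure G).
    apply/measurable_EFinP; apply: measurable_fun_ifT => //.
      by apply: measurable_and; [apply: measurable_fun_ler|apply: measurable_fun_ltr] => //;
        exact: measurable_snd.
    apply: mPhi.
    - exact: measurable_snd.
    - exact: (measurableT_comp (mlo n) measurable_fst).
    - exact: (measurableT_comp (mhi n) measurable_fst).
  by move=> z; rewrite lee_fin /on_unit; case: ifP.
have F0 w : (0 <= \int[lebesgue_measure]_v
     (on_unit (fun v => Phi del v (lo n w) (hi n w)) v)%:E)%E.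
  by apply: integral_ge0 => v _; rewrite lee_fin /on_unit; case: ifP.
have theta1' : (0 <= (1 - theta)%:E)%E by rewrite lee_fin subr_ge0.
rewrite /averaged -ge0_integralZl//.
apply: ge0_le_integral => //.
- by move=> w _; rewrite mule_ge0.
- exact: measurable_funeM.
- have mZs : measurable_fun setT (fun z : (R * (R * R)) * T => (z.1, Z n n z.2)).
    apply: measurable_fun_pair; first exact: measurable_fst.
    exact: (measurableT_comp (mZ n n) measurable_snd).
  have := @measurable_fun_fubini_tonelli_F _ _ _ _ _ P _
    (measurableT_comp mg mZs) (fun z => g0 _).
  by move=> H; exact: (measurableT_comp H mst).
move=> w _; rewrite /g /=.
under [leRHS]eq_integral do rewrite ZE opprK.
pose h x := (Phi del (fractional (k * x - pos n w)) (lo n w) (hi n w))%:E.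
rewrite (@integral_normal_law _ _ _ P (delta n n) s (mdelta n n) _ h).
- apply: (@equidistribution _ s k s_gt0 k_gt0 (fun v => Phi del v (lo n w) (hi n w))) => //.
  exact: mPhi.
- by move=> A mA; exact: (wiener_last_increment_law W_wiener).
- apply/measurable_EFinP; apply: mPhi => //.
  by apply: (measurableT_comp (@measurable_fractional R)); exact: measurable_funB.
- by move=> x; rewrite lee_fin.
Qed.

Let tent v := f v * (1 - v) + f (v - 1) * v.

(** For a fixed [v], the probabilities of the two announcements are at least
    [1 - v] and [v], up to an error; then Tonelli. *)
Let averaged_ge n del e : (0 < n)%N -> 0 < del -> 0 < e ->
  (\int[lebesgue_measure]_v (on_unit tent v)%:E <=
   averaged n del + (2 * C * (2 * del + err n e))%:E)%E.
Proof.
move=> n0 del0 e0; have E0 := err_ge0 n e0; have CC := C0.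
pose c := 2 * C * (2 * del + err n e).
have c0 : 0 <= c by rewrite !mulr_ge0// addr_ge0// mulr_ge0// ltW.
pose G (z : T * measurableTypeR R) :=
  (on_unit (fun v => Phi del v (lo n z.1) (hi n z.1)) z.2)%:E.
have mG : measurable_fun setT G.
  apply/measurable_EFinP; apply: measurable_fun_ifT => //.
    by apply: measurable_and; [apply: measurable_fun_ler|apply: measurable_fun_ltr] => //;
      exact: measurable_snd.
  apply: mPhi.
  - exact: measurable_snd.
  - exact: (measurableT_comp (mlo n) measurable_fst).
  - exact: (measurableT_comp (mhi n) measurable_fst).
have G0 z : (0 <= G z)%E by rewrite lee_fin /on_unit; case: ifP.
have -> : averaged n del = (\int[lebesgue_measure]_v \int[P]_w G (w, v))%E.
  by rewrite -(@fubini_tonelli _ _ _ _ _ P lebesgue_measure G).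
have mH := @measurable_fun_fubini_tonelli_G _ _ _ _ _ P G mG G0.
have unit1 : (\int[lebesgue_measure]_v (c%:E * (on_unit (fun=> 1) v)%:E) = c%:E)%E.
  rewrite ge0_integralZl//.
  - by rewrite integral_on_unit1 mule1.
  - by apply/measurable_EFinP; exact: measurable_on_unit.
  - by move=> v _; rewrite lee_fin /on_unit; case: ifP.
have mtent : measurable_fun setT tent.
  apply: measurable_funD; apply: measurable_funM => //.
    exact: measurable_funB.
  by apply: (measurableT_comp mf); exact: measurable_funB.
have m1 : measurable_fun setT (fun v => c%:E * (on_unit (fun=> 1) v)%:E)%E.
  by apply: measurable_funeM; apply/measurable_EFinP; exact: measurable_on_unit.
rewrite -[X in (_ <= _ + X)%E]unit1 -ge0_integralD//; last 2 first.
- by move=> v _; apply: integral_ge0.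
- by move=> v _; rewrite -EFinM lee_fin mulr_ge0// /on_unit; case: ifP.
apply: ge0_le_integral => //.
- move=> v _; rewrite lee_fin /on_unit; case: ifP => // v01.
  by rewrite addr_ge0// mulr_ge0//; lra.
- by apply/measurable_EFinP; exact: measurable_on_unit.
- exact: emeasurable_funD.
move=> v _; rewrite /G /on_unit /=; case: ifPn => [v01|_]; last first.
  by rewrite mule0 adde0; apply: integral_ge0.
have ml : measurable_fun setT (fun w => v + del < lo n w) by exact: measurable_fun_ltr.
have mh : measurable_fun setT (fun w => hi n w < v - del) by exact: measurable_fun_ltr.
have -> : (\int[P]_w (Phi del v (lo n w) (hi n w))%:E =
   (f v)%:E * P [set w | (v + del < lo n w)%R] +
   (f (v - 1))%:E * P [set w | (hi n w < v - del)%R])%E.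
  rewrite -integral_indicator// -[X in (_ = _ + _ * X)%E]integral_indicator//.
  rewrite -!ge0_integralZl//; last 6 first.
  - by apply/measurable_EFinP; exact: measurable_fun_ifT.
  - by move=> w _; rewrite lee_fin; case: ifP.
  - by rewrite lee_fin.
  - by apply/measurable_EFinP; exact: measurable_fun_ifT.
  - by move=> w _; rewrite lee_fin; case: ifP.
  - by rewrite lee_fin.
  rewrite -ge0_integralD//; last 4 first.
  - by move=> w _; rewrite -EFinM lee_fin mulr_ge0//; case: ifP.
  - by apply/measurable_EFinP; apply: measurable_funM => //; exact: measurable_fun_ifT.
  - by move=> w _; rewrite -EFinM lee_fin mulr_ge0//; case: ifP.
  - by apply/measurable_EFinP; apply: measurable_funM => //; exact: measurable_fun_ifT.
  apply: eq_integral => w _; rewrite -!EFinM -EFinD; congr EFin; rewrite /Phi.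
  by case: ifP => _; case: ifP => _; rewrite ?mulr1 ?mulr0.
have Hl := lo_probability n0 del0 e0 v01; have Hh := hi_probability n0 del0 e0 v01.
have pl : P [set w | v + del < lo n w] = (fine (P [set w | v + del < lo n w]))%:E.
  by rewrite fineK// fin_num_measure//; exact: measurable_event.
have ph : P [set w | hi n w < v - del] = (fine (P [set w | hi n w < v - del]))%:E.
  by rewrite fineK// fin_num_measure//; exact: measurable_event.
rewrite pl ph -!EFinM -!EFinD lee_fin /tent mulr1.
move: Hl Hh; set p1 := fine _; set p2 := fine _; set E := 2 * del + err n e => Hl Hh.
have EE : 0 <= E by rewrite addr_ge0// mulr_ge0// ltW.
have := ler_wpM2l (f0 v) Hl; have := ler_wpM2l (f0 (v - 1)) Hh.
have := ler_wpM2r EE (fC v); have := ler_wpM2r EE (fC (v - 1)).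
by rewrite /c -/E; lra.
Qed.

Let finite_lower_bound n del e : (0 < n)%N -> 0 < del -> 0 < e -> theta <= 1 ->
  ((1 - theta)%:E * \int[lebesgue_measure]_v (on_unit tent v)%:E <=
   \int[P]_w (f (Y w))%:E + (2 * C)%:E * P [set w | missed n del w] +
   (2 * C * (2 * del + err n e))%:E)%E.
Proof.
move=> n0 del0 e0 theta1.
have theta0 : 0 <= theta by exact: equidistribution_error_ge0.
have c0 : 0 <= 2 * C * (2 * del + err n e).
  by rewrite !mulr_ge0 ?C0// addr_ge0 ?err_ge0// mulr_ge0// ltW.
have theta1' : 0 <= 1 - theta by rewrite subr_ge0.
have av0 : (0 <= averaged n del)%E.
  by apply: integral_ge0 => w _; apply: integral_ge0 => v _; rewrite lee_fin /on_unit; case: ifP.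
apply: (@le_trans _ _ ((1 - theta)%:E * (averaged n del + (2 * C * (2 * del + err n e))%:E))%E).
  by rewrite lee_wpmul2l ?lee_fin// averaged_ge.
rewrite ge0_muleDr//.
rewrite leeD//.
  by rewrite (le_trans (averaged_le n0 del0 theta1))// integral_remainder_ge.
by rewrite -EFinM lee_fin ler_piMl//; lra.
Qed.

Let sum_fourth_moments n : (0 < n)%N -> n%:R * M n = 30 * k ^+ 4 * (t / 2) ^+ 2 / n%:R.
Proof.
move=> n0; have n0' : (n%:R : R) != 0 by rewrite pnatr_eq0 -lt0n.
have h0 : 0 <= t / 2 / n%:R by rewrite !divr_ge0// ltW.
rewrite /M (_ : step n ^+ 4 = (t / 2 / n%:R) ^+ 2); first by field.
by rewrite -(sqr_sqrtr h0) -exprM.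
Qed.

(** The grid is refined with [eta] fixed, then the margin [del] and the truncation
    level [e] of the overshoot, taken equal, tend to [0]. *)
Lemma remainder_lower_bound : theta <= 1 ->
  ((1 - theta)%:E * \int[lebesgue_measure]_v (on_unit tent v)%:E <=
   \int[P]_w (f (Y w))%:E + (2 * C * unexited_bound)%:E)%E.
Proof.
move=> theta1; apply/lee_addgt0Pr => x x0.
have CC := C0.
(* Each of the four errors below is at most a multiple of [C * e]; [10] covers
   their sum, and the last [e] keeps it positive when [C = 0]. *)
have [e e0 xE] : exists2 e, 0 < e & x = 10 * (C * e) + e.
  have C1 : 0 < 10 * C + 1 by lra.
  by exists (x / (10 * C + 1)); [exact: divr_gt0|field; rewrite gt_eqF].
pose K := 30 * k ^+ 4 * (t / 2) ^+ 2.
have [n [n0 Pn Kn]] : exists n, [/\ (0 < n)%N, fine (P [set w | missed n e w]) < e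
    & K / e ^+ 4 < n%:R].
  have /fine_cvgP[_ /cvgrPdist_lt/(_ e e0) H] := missed_cvg0 e0.
  near \oo => n; exists n; split.
  - by near: n; exact: nbhs_infty_gt.
  - have : `|0 - fine (P [set w | missed n e w])| < e by near: n; exact: H.
    by rewrite sub0r normrN => /(le_lt_trans (ler_norm _)).
  - by near: n; exact: nbhs_infty_gtr.
have n0' : 0 < (n%:R : R) by rewrite ltr0n.
apply: (le_trans (finite_lower_bound n0 e0 e0 theta1)).
have Pfin : P [set w | missed n e w] \is a fin_num.
  by rewrite fin_num_measure//; exact: measurable_event.
rewrite -addeA -[leRHS]addeA leeD2l// -(fineK Pfin) -EFinM -!EFinD lee_fin.
set p := fine _ in Pn *.
have Kb : n%:R * M n / e ^+ 3 <= e.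
  rewrite sum_fourth_moments// -/K -mulrA -invfM ler_pdivrMr; last by rewrite mulr_gt0// exprn_gt0.
  move: Kn; rewrite ltr_pdivrMr ?exprn_gt0// => /ltW /le_trans; apply.
  by rewrite [leRHS]mulrCA -exprS.
have h1 := ler_wpM2l CC (ltW Pn); have h2 := ler_wpM2l CC Kb.
rewrite /err xE; lra.
Unshelve. all: end_near. Qed.

End test_function.
End one_sided_bound.

(** * Convergence to the triangular law *)

(** The negative half of the line is translated onto the unit interval. *)
Lemma triangular_expectation d (T : measurableType d) (R : realType)
    (P : probability T R) (L : {RV P >-> R}) (f : R -> R) :
  has_density L (fun z : R => Num.max (1 - `|z|) 0) ->
  measurable_fun setT f -> (forall x, 0 <= f x) ->
  (\int[P]_w (f (L w))%:E =
   \int[lebesgue_measure]_v (on_unit (fun v => f v * (1 - v) + f (v - 1) * v) v)%:E)%E.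
Proof.
move=> [mp p0 Lp] mf f0.
pose g1 v := if 0 <= v < 1 then f v * (1 - v) else 0.
pose g2 v := if -1 <= v < 0 then f v * (1 + v) else 0.
have mg1 : measurable_fun setT g1.
  by apply: measurable_on_itv; apply: measurable_funM => //; exact: measurable_funB.
have mg2 : measurable_fun setT g2.
  by apply: measurable_on_itv; apply: measurable_funM => //; exact: measurable_funD.
have g10 v : 0 <= g1 v by rewrite /g1; case: ifP => // v01; rewrite mulr_ge0//; lra.
have g20 v : 0 <= g2 v by rewrite /g2; case: ifP => // v01; rewrite mulr_ge0//; lra.
have mL : measurable_fun setT (L : T -> R) by exact: measurable_funPT.
have mEf : measurable_fun setT (EFin \o f) by exact/measurable_EFinP.
rewrite (integral_law_density mL mp p0 Lp mEf)/=; last by move=> x; rewrite lee_fin.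
have mt : measurable_fun setT (fun x : R => x + -1) by exact: measurable_funD.
transitivity (\int[lebesgue_measure]_v ((g1 v)%:E + (g2 v)%:E))%E.
  apply: eq_integral => v _; rewrite -EFinM -EFinD; congr EFin; rewrite /g1 /g2.
  have [v0|v0] := leP 0 v.
    rewrite ger0_norm// andbF addr0 /=; have [v1|v1] := ltP v 1.
      by rewrite max_l//; lra.
    by rewrite max_r ?mulr0//; lra.
  rewrite ltr0_norm// opprK /= add0r andbT; have [v1|v1] := leP (-1) v.
    by rewrite max_l//; lra.
  by rewrite max_r ?mulr0//; lra.
rewrite ge0_integralD//; last 4 first.
- by move=> v _; rewrite lee_fin.
- exact/measurable_EFinP.
- by move=> v _; rewrite lee_fin.
- exact/measurable_EFinP.
rewrite -(@ge0_integral_translation _ (fun v => (g2 v)%:E) (-1)); last 2 first.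
- exact/measurable_EFinP.
- by move=> v; rewrite lee_fin.
rewrite -ge0_integralD//; last 4 first.
- by move=> v _; rewrite lee_fin.
- exact/measurable_EFinP.
- by move=> v _; rewrite lee_fin.
- by apply/measurable_EFinP; exact: (measurableT_comp mg2 mt).
apply: eq_integral => v _; rewrite -EFinD; congr EFin; rewrite /g1 /g2 /on_unit.
have -> : (-1 <= v + -1 < 0) = (0 <= v < 1) by apply/idP/idP; lra.
by case: ifP => _; rewrite ?addr0// addrCA subrr addr0.
Qed.

Lemma bounded_expectation d (T : measurableType d) (R : realType)
    (P : probability T R) (h : T -> R) (C : R) :
  measurable_fun setT h -> (forall w, `|h w| <= C) ->
  exists b, [/\ (\int[P]_w (h w)%:E = b%:E)%E,
    (\int[P]_w (h w + C)%:E = (b + C)%:E)%E,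
    (\int[P]_w (C - h w)%:E = (C - b)%:E)%E & `|b| <= C].
Proof.
move=> mh hC.
have ic : P.-integrable setT (EFin \o (fun=> C : R)).
  exact: finite_measure_integrable_cst.
have ih : P.-integrable setT (EFin \o h).
  apply: le_integrable ic => //; first exact/measurable_EFinP.
  by move=> w _; rewrite /= lee_fin (le_trans (hC w))// ler_norm.
have cE : (\int[P]_w (C%:E) = C%:E)%E by rewrite integral_cst//= probability_setT mule1.
have hfin : (\int[P]_w (h w)%:E)%E \is a fin_num by exact: integrable_fin_num.
exists (fine (\int[P]_w (h w)%:E)%E); have hE := fineK hfin.
have e2 : (\int[P]_w (h w + C)%:E = (fine (\int[P]_w (h w)%:E) + C)%:E)%E.
  by rewrite EFinD hE -[X in (_ + X)%E]cE -integralD_EFin.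
have e3 : (\int[P]_w (C - h w)%:E = (C - fine (\int[P]_w (h w)%:E))%:E)%E.
  by rewrite EFinB hE -[X in (X - _)%E]cE -integralB_EFin.
split => //.
have p2 : (0 <= \int[P]_w (h w + C)%:E)%E.
  by apply: integral_ge0 => w _; rewrite lee_fin; have := hC w; rewrite ler_norml; lra.
have p3 : (0 <= \int[P]_w (C - h w)%:E)%E.
  by apply: integral_ge0 => w _; rewrite lee_fin; have := hC w; rewrite ler_norml; lra.
by move: p2 p3; rewrite e2 e3 !lee_fin ler_norml; lra.
Qed.

Section triangular_limit.
Context d (T : measurableType d) (R : realType) (P : probability T R).
Context d' (T' : measurableType d') (P' : probability T' R).
Variables (W : R -> T -> R) (sigma t : R) (L : {RV P' >-> R}).
Hypotheses (sigma_gt0 : 0 < sigma) (t_gt0 : 0 < t) (W_wiener : wiener_process P W)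
  (L_density : has_density L (fun z : R => Num.max (1 - `|z|) 0)).

Let X s w := sigma * W s w.
Let Y eta w := eta^-1 * (X t w - X (last_discr_time (fun s => X s w) eta t) w).
Let theta eta := equidistribution_error (Num.sqrt (t / 2)) (sigma / eta).
Let rho eta := unexited_bound sigma t eta.

(** The lower bound is applied to [f + C] and to [C - f]. *)
Lemma remainder_expectation_gap (f : R -> R) C eta :
  measurable_fun setT f -> (forall x, `|f x| <= C) -> 0 < eta -> theta eta <= 1 ->
  exists b, (\int[P]_w (f (Y eta w))%:E = b%:E)%E /\
    exists2 a, (\int[P']_w (f (L w))%:E = a%:E)%E &
    `|b - a| <= 2 * C * theta eta + 4 * C * rho eta.
Proof.
move=> mf fC eta_gt0 theta1.
have mY : measurable_fun setT (Y eta).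
  exact: (measurable_scaled_remainder sigma W_wiener t_gt0 eta_gt0).
have fC' x : - C <= f x <= C by rewrite -ler_norml.
have [b [bE b1 b2 _]] := bounded_expectation P (measurableT_comp mf mY) (fun w => fC _).
have mL : measurable_fun setT (f \o L) by exact: measurableT_comp.
have [a [aE a1 a2 aC]] := bounded_expectation P' mL (fun w => fC _).
exists b; split => //; exists a => //.
have bound (g : R -> R) : measurable_fun setT g -> (forall x, 0 <= g x) ->
    (forall x, g x <= 2 * C) ->
    ((1 - theta eta)%:E * \int[P']_w (g (L w))%:E <=
     \int[P]_w (g (Y eta w))%:E + (2 * (2 * C) * rho eta)%:E)%E.
  move=> mg g0 gC; rewrite (triangular_expectation L_density mg g0).
  exact: (remainder_lower_bound W_wiener sigma_gt0 t_gt0 eta_gt0 mg g0 gC theta1).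
have H1 : (1 - theta eta) * (a + C) <= b + C + 2 * (2 * C) * rho eta.
  rewrite -lee_fin EFinM [leRHS]EFinD -a1 -b1; apply: (bound (fun x => f x + C)).
  - exact: measurable_funD.
  - by move=> x; have := fC' x; lra.
  - by move=> x; have := fC' x; lra.
have H2 : (1 - theta eta) * (C - a) <= C - b + 2 * (2 * C) * rho eta.
  rewrite -lee_fin EFinM [leRHS]EFinD -a2 -b2; apply: (bound (fun x => C - f x)).
  - exact: measurable_funB.
  - by move=> x; have := fC' x; lra.
  - by move=> x; have := fC' x; lra.
have theta0 : 0 <= theta eta.
  by apply: equidistribution_error_ge0; rewrite ?sqrtr_gt0 divr_gt0.
move: aC; rewrite !ler_norml => /andP[aC1 aC2].
have h1 := ler_wpM2l theta0 aC1; have h2 := ler_wpM2l theta0 aC2.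
apply/andP; split; lra.
Qed.

Let theta_cvg0 : theta eta @[eta --> 0^'+] --> 0.
Proof.
pose A := (2 * sigma^-1 * (1 + 30 * Num.sqrt (t / 2) ^+ 4)) / (2 * Num.sqrt (t / 2) ^+ 2).
pose B := sigma^-1 ^+ 2 / (2 * Num.sqrt (t / 2) ^+ 2).
have -> : theta = fun eta => A * eta + B * (eta * eta).
  by apply/funext => eta; rewrite /theta /equidistribution_error invf_div /A /B; ring.
have id0 : (eta : R) @[eta --> 0^'+] --> (0 : R).
  by apply: cvg_at_right_filter; exact: cvg_id.
rewrite -[X in _ --> X](_ : A * 0 + B * (0 * 0) = 0); last by rewrite !mulr0 addr0.
by apply: cvgD; apply: cvgMr => //; exact: cvgM.
Qed.

Let rho_cvg0 : rho eta @[eta --> 0^'+] --> 0.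
Proof.
have -> : rho = fun eta => (2 * sigma^-1 * normal_peak (Num.sqrt (t / 2))) * eta.
  by apply/funext => eta; rewrite /rho /unexited_bound invf_div; ring.
rewrite -[X in _ --> X](mulr0 (2 * sigma^-1 * normal_peak (Num.sqrt (t / 2)))).
by apply: cvgMr; apply: cvg_at_right_filter; exact: cvg_id.
Qed.

Lemma remainder_cvg_triangular : cvg_in_distribution_at0 P Y L.
Proof.
split=> [eta eta0|f cf [C0 [_ fC0]]].
  exact: (measurable_scaled_remainder sigma W_wiener t_gt0 eta0).
pose C := C0 + 1.
have fC x : `|f x| <= C by apply: (fC0 C _ x) => //; rewrite /C ltrDl.
have mf : measurable_fun setT f by exact: continuous_measurable_fun.
have mL : measurable_fun setT (f \o L) by exact: measurableT_comp.
have [a [aE _ _ _]] := bounded_expectation P' mL (fun w => fC _).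
rewrite unlock /= aE.
pose c eta := 2 * C * theta eta + 4 * C * rho eta.
have c0 : c eta @[eta --> 0^'+] --> 0.
  rewrite -[X in _ --> X](_ : 2 * C * 0 + 4 * C * 0 = 0); last by rewrite !mulr0 addr0.
  by apply: cvgD; exact: cvgMr.
apply: (@squeeze_cvge _ _ _ _ (fun eta => (a - c eta)%:E) _ (fun eta => (a + c eta)%:E)).
- near=> eta.
  have eta0 : 0 < eta by near: eta; exact: nbhs_right_gt.
  have th1 : theta eta <= 1 by near: eta; apply: (cvgr_le _ theta_cvg0); exact: ltr01.
  have [b [bE [a' a'E]]] := remainder_expectation_gap mf fC eta0 th1.
  have -> : a' = a by apply: EFin_inj; rewrite -a'E -aE.
  rewrite bE !lee_fin -/(c eta) ler_norml; lra.
- apply: cvg_EFin; first exact: nearW.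
  by rewrite -[X in _ --> X]subr0; apply: cvgB => //; exact: cvg_cst.
- apply: cvg_EFin; first exact: nearW.
  by rewrite -[X in _ --> X]addr0; apply: cvgD => //; exact: cvg_cst.
Unshelve. all: end_near. Qed.

End triangular_limit.

Unset Implicit Arguments.

Theorem theorem1 (R : realType) (d : measure_display) (T : measurableType d)
    (P : probability T R) (W : R -> T -> R) (sigma t : R)
    (d' : measure_display) (T' : measurableType d') (P' : probability T' R)
    (Lambda : {RV P' >-> R})
    (sigma_gt0 : 0 < sigma) (t_gt0 : 0 < t)
    (W_wiener : wiener_process P W)
    (Lambda_density : has_density Lambda (fun z : R => Num.max (1 - `|z|) 0)) :
  let X := fun (s : R) (w : T) => sigma * W s w in
  let phi := fun (eta : R) (w : T) =>
    last_discr_time (fun s : R => X s w) eta t in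
  cvg_in_distribution_at0 P
    (fun eta w => eta^-1 * (X t w - X (phi eta w) w)) Lambda.
Proof. exact: remainder_cvg_triangular. Qed.
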